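(* Let $\omega>0$, $\alpha\ge 0$ and $k>0$ be constants, and let $(\eta_t)_{t\in\mathbb{Z}}$ be an i.i.d. sequence of real random variables such that $E\eta_t=0$, $E\eta_t^2=1$, and $\eta_t^2$ admits a density $f$ with respect to the Lebesgue measure on $\mathbb{R}^+=[0,\infty)$ with $f>0$ on $\mathbb{R}^+$. Then there exists a strictly stationary solution $(\varepsilon_t)$ to the model $$\varepsilon_t=\sigma_t\eta_t,\qquad \sigma_t^2=\omega+\alpha\,\varepsilon_{t-1}^2\,\mathbb{1}_{\varepsilon_{t-1}^2>k\varepsilon_{t-2}^2},\qquad \sigma_t>0 .$$ This solution is $\beta$-mixing, and hence strongly mixing, with geometric rate. Moreover, there exists $r>0$ such that, under the stationary distribution, $E(|\varepsilon_t|^{2r})<\infty$.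
   Context: A solution of the model is a process $(\varepsilon_t)$, defined together with an i.i.d. sequence $(\eta_t)$ of the prescribed law on some probability space, which satisfies the displayed equations almost surely for every $t$, where $\eta_t$ is independent of the past $\{\varepsilon_s : s<t\}$ (so that $\sigma_t$, a measurable function of the past, is independent of $\eta_t$). For a stationary process $X=(X_t)$, the $\beta$-mixing coefficients are $$\beta_X(n)=E\sup_{B\in\sigma(X_s,\,s\ge n)}\bigl|\mathbb{P}(B\mid\sigma(X_s,\,s\le 0))-\mathbb{P}(B)\bigr| .$$ The process is $\beta$-mixing if $\beta_X(n)\to0$ as $n\to\infty$, and $\beta$-mixing with geometric rate if $\beta_X(n)=O(\rho^n)$ for some $\rho\in(0,1)$. Strong mixing with geometric rate is defined in the same way from the strong mixing coefficients $\sup\{|\mathbb{P}(A\cap B)-\mathbb{P}(A)\mathbb{P}(B)| : A\in\sigma(X_s,\,s\le 0),\ B\in\sigma(X_s,\,s\ge n)\}$. *)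

(* Defs.v *)
From HB Require Import structures.
From mathcomp Require Import all_boot all_order all_algebra.
From mathcomp Require Import all_classical all_reals all_analysis.
From mathcomp Require Import measurable_realfun.

Set Implicit Arguments.
Unset Strict Implicit.
Unset Printing Implicit Defensive.

Import Order.TTheory GRing.Theory Num.Theory.
Import numFieldNormedType.Exports.

Local Open Scope classical_set_scope.
Local Open Scope ring_scope.

Section processes.
Context d (T : measurableType d) (R : realType) (P : probability T R).
Implicit Type X : int -> {RV P >-> R}.

(* sigma(X_s, s in S) *)
Definition sigma_process X (S : set int) : set (set T) :=
  <<s \bigcup_(s in S) preimage_set_system [set: T] (X s) measurable >>.

Definition strictly_stationary X : Prop :=
  forall (m : nat) (t : m.-tuple int) (h : int) (B : set (m.-tuple R)),
    measurable B ->
    P [set w | B [tuple X (tnth t i + h) w | i < m]] =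
    P [set w | B [tuple X (tnth t i) w | i < m]].

Definition mutually_independent X : Prop :=
  forall (s : seq int) (A : int -> set R), uniq s ->
    (forall t, measurable (A t)) ->
    (P (\big[setI/setT]_(t <- s) (X t @^-1` A t)) =
     \prod_(t <- s) P (X t @^-1` A t))%E.

Definition identically_distributed X : Prop :=
  forall (s t : int) (A : set R), measurable A ->
    distribution P (X s) A = distribution P (X t) A.

Definition iid X : Prop := mutually_independent X /\ identically_distributed X.

Definition indep_of_sigma (Y : {RV P >-> R}) (F : set (set T)) : Prop :=
  forall (A : set R) (B : set T), measurable A -> F B ->
    (P ((Y @^-1` A) `&` B) = P (Y @^-1` A) * P B)%E.

(* p is a version of the conditional probability P(B | F), F a sub-sigma-algebra
   of the measurable sets of T *)
Definition cond_prob_version (F : set (set T)) (B : set T) (p : T -> R) : Prop :=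
  [/\ forall Y : set R, measurable Y -> F (p @^-1` Y),
      P.-integrable [set: T] (EFin \o p) &
      forall A, F A -> (\int[P]_(w in A) (p w)%:E)%E = P (A `&` B)].

(* g is the P-essential supremum of a (possibly uncountable) family of
   functions, i.e. its least upper bound for the almost sure order; not to be
   confused with the library's ess_sup, which is the essential supremum of one
   function over its domain. *)
Definition is_family_ess_sup (S : set (T -> \bar R)) (g : T -> \bar R) : Prop :=
  [/\ measurable_fun [set: T] g,
      forall h, S h -> \forall w \ae P, (h w <= g w)%E &
      forall g', measurable_fun [set: T] g' ->
        (forall h, S h -> \forall w \ae P, (h w <= g' w)%E) ->
        \forall w \ae P, (g w <= g' w)%E].

(* The essential supremum always exists and is unique up to a null set; the
   default value +oo is never used for families of measurable functions. *)
Definition family_ess_sup (S : set (T -> \bar R)) : T -> \bar R :=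
  xget (cst +oo%E) [set g | is_family_ess_sup S g].

(* E sup_(B in G) |P(B | F) - P(B)|.  As P(B | F) is only defined up to a null
   set and G is uncountable, the supremum is the essential one. *)
Definition beta_coef (F G : set (set T)) : \bar R :=
  (\int[P]_w family_ess_sup
    [set h | exists B p, [/\ G B, cond_prob_version F B p &
       h = fun w => `| (p w)%:E - P B |]] w)%E.

Definition alpha_coef (F G : set (set T)) : \bar R :=
  ereal_sup [set x | exists A B, [/\ F A, G B &
    x = `| P (A `&` B) - P A * P B |%E]].

Definition beta_mixing_coef X (n : nat) : \bar R :=
  beta_coef (sigma_process X [set s | s <= 0])
            (sigma_process X [set s | n%:Z <= s]).

Definition strong_mixing_coef X (n : nat) : \bar R :=
  alpha_coef (sigma_process X [set s | s <= 0])
             (sigma_process X [set s | n%:Z <= s]).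

Definition geometric_rate (b : nat -> \bar R) : Prop :=
  exists C rho : R, [/\ 0 < rho, rho < 1 &
    forall n, (b n <= (C * rho ^+ n)%:E)%E].

Definition geometrically_beta_mixing X : Prop :=
  geometric_rate (beta_mixing_coef X).

Definition geometrically_strong_mixing X : Prop :=
  geometric_rate (strong_mixing_coef X).

Definition model_equations (omega alpha k : R)
    (eps sigma eta : int -> {RV P >-> R}) : Prop :=
  forall t : int, \forall w \ae P,
    [/\ eps t w = sigma t w * eta t w,
        sigma t w ^+ 2 = omega + alpha * eps (t - 1) w ^+ 2 *
          (eps (t - 1) w ^+ 2 > k * eps (t - 2) w ^+ 2)%R%:R &
        0 < sigma t w].

(* nu is the prescribed law of the innovations *)
Definition solution (omega alpha k : R) (nu : set R -> \bar R)
    (eps eta : int -> {RV P >-> R}) : Prop :=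
  [/\ iid eta,
      forall (t : int) (A : set R), measurable A ->
        distribution P (eta t) A = nu A,
      exists sigma : int -> {RV P >-> R},
        model_equations omega alpha k eps sigma eta &
      forall t : int, indep_of_sigma (eta t) (sigma_process eps [set s | s < t])].

End processes.

(* Y^2 has density f with respect to the Lebesgue measure on [0, +oo[. *)
Definition square_has_density d (T : measurableType d) (R : realType)
    (P : probability T R) (Y : {RV P >-> R}) (f : R -> R) : Prop :=
  measurable_fun (`[0, +oo[%classic : set R) f /\
  forall A : set R, measurable A ->
    P [set w | A (Y w ^+ 2)] =
    (\int[@lebesgue_measure R]_(x in A `&` `[0%R, +oo[) (f x)%:E)%E.

(* Main.v *)
(* The volatility recursion forgets its initial state after finitely many
   steps.  Put c = k / (1 + alpha).  If eta_s^2 >= 1 then eps_s^2 >= omega, so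
   sigma_(s+1)^2 <= (1 + alpha) eps_s^2 and eta_(s+1)^2 <= c forces
   eps_(s+1)^2 <= k eps_s^2, that is sigma_(s+2)^2 = omega; if moreover
   eta_(s+1)^2 >= c / 2 and eta_(s+2)^2 <= k c / 2, then also
   sigma_(s+3)^2 = omega, whatever the state before time s.  Since eta^2 has a
   positive density this event has probability delta > 0, and it depends on
   three innovations only.  Hence almost surely eps_t is a function of finitely
   many past innovations (coupling from the past).  On the event of a renewal
   between the times 1 and n, of probability at least 1 - (1 - delta)^(n / 4),
   the process after time n is a function of the innovations from time 1 on,
   which are independent of the process up to time 0: this yields both mixing
   rates.

   For the moment, 1 + eps^2 grows at most by the factor
   1 + (omega + alpha) eta_s^2 in one step and is reset by a renewal; with
   r = 1 / (4 n) and n large, the r-th power of 1 + eps^2 over blocks of four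
   steps satisfies a geometric drift inequality of ratio less than 1. *)
Require Import Defs.
From HB Require Import structures.
From mathcomp Require Import all_boot all_order all_algebra.
From mathcomp Require Import all_classical all_reals all_analysis.
From mathcomp Require Import measurable_realfun.
From mathcomp Require Import ring lra zify.

Set Implicit Arguments.
Unset Strict Implicit.
Unset Printing Implicit Defensive.

Import Order.TTheory GRing.Theory Num.Theory.
Import numFieldNormedType.Exports.

Local Open Scope classical_set_scope.
Local Open Scope ring_scope.

(** * The volatility recursion *)

Section recursion.
Variables (R : realType) (omega alpha k : R).
Implicit Types (x : int -> R) (z : R * R) (s t a : int).

Definition volatility z : R :=
  Num.sqrt (omega + alpha * z.1 ^+ 2 * (z.1 ^+ 2 > k * z.2 ^+ 2)%R%:R).

(* The state before time t is (eps_(t-1), eps_(t-2)); [run x s z n] is the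
   state before time s + n when it is z before time s. *)
Fixpoint run x s z (n : nat) : R * R :=
  if n is m.+1 then
    let y := run x s z m in (volatility y * x (s + m%:Z), y.1)
  else z.

Lemma runD x s z n m : run x s z (n + m) = run x (s + n%:Z) (run x s z n) m.
Proof.
elim: m => [|m IHm]; first by rewrite addn0.
by rewrite addnS /= IHm PoszD addrA.
Qed.

Lemma run_shift x h s z n :
  run (fun t => x (t + h)) s z n = run x (s + h) z n.
Proof. by elim: n => //= n ->; rewrite addrAC. Qed.

Let c := k / (1 + alpha).

(** Each condition bears on a single innovation, so that [forgetful] is a cylinder event whose
    probability is a product. *)
Definition forgetful_set (i : nat) : set R :=
  match i with
  | 0 => [set y | 1 <= y ^+ 2]
  | 1 => [set y | c / 2 <= y ^+ 2 <= c]
  | _ => [set y | y ^+ 2 <= k * c / 2]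
  end.

Definition forgetful x s : Prop :=
  [/\ forgetful_set 0 (x s), forgetful_set 1 (x (s + 1)) &
      forgetful_set 2 (x (s + 2))].

(** [forgetful x a] reads three innovations, but a state holds two values: after three steps the
    older one may still depend on the initial state, whence [a + 4]. *)
Definition renewed x s t : Prop :=
  exists a, [/\ s <= a, a + 4 <= t & forgetful x a].

Lemma renewedS x s s' t : s' <= s -> renewed x s t -> renewed x s' t.
Proof. by move=> ss [a [sa at_ fa]]; exists a; split => //; lia. Qed.

(* A junk value on the paths without a renewal before time t. *)
Definition stationary x t : R :=
  fine (limn_esup (fun n => (run x (t + 1 - n%:Z) (0, 0) n).1%:E)).

(** Strict stationarity comes from this equivariance, since a time shift preserves the law of i.i.d.
    innovations. *)
Lemma stationary_shift x h t :
  stationary (fun u => x (u + h)) t = stationary x (t + h).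
Proof.
rewrite /stationary; congr (fine (limn_esup _)); apply/funext => n.
by rewrite run_shift; congr ((run x _ _ _).1%:E); lia.
Qed.

Hypotheses (omega_gt0 : 0 < omega) (alpha_ge0 : 0 <= alpha) (k_gt0 : 0 < k).

Let alpha_sqr_ge0 (y : R) (b : bool) : 0 <= alpha * y ^+ 2 * b%:R.
Proof. by apply: mulr_ge0 => //; exact: mulr_ge0 alpha_ge0 (sqr_ge0 _). Qed.

Lemma volatility_sqr z :
  volatility z ^+ 2 =
  omega + alpha * z.1 ^+ 2 * (z.1 ^+ 2 > k * z.2 ^+ 2)%R%:R.
Proof. by rewrite sqr_sqrtr// addr_ge0// ltW. Qed.

Lemma volatility_gt0 z : 0 < volatility z.
Proof. by rewrite sqrtr_gt0 ltr_wpDr. Qed.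

Lemma volatility_sqr_ge z : omega <= volatility z ^+ 2.
Proof. by rewrite volatility_sqr lerDl. Qed.

Lemma volatility_sqr_le z : volatility z ^+ 2 <= omega + alpha * z.1 ^+ 2.
Proof.
rewrite volatility_sqr lerD2l ler_piMr//.
  exact: mulr_ge0 alpha_ge0 (sqr_ge0 _).
by case: (_ < _).
Qed.

Lemma volatility_reset z : z.1 ^+ 2 <= k * z.2 ^+ 2 ->
  volatility z = Num.sqrt omega.
Proof. by move=> h; rewrite /volatility ltNge h mulr0 addr0. Qed.

Lemma run_forgetful x s z : forgetful x s ->
  run x s z 4 = (Num.sqrt omega * x (s + 3), Num.sqrt omega * x (s + 2)).
Proof.
case; rewrite /forgetful_set /= => x0 /andP[x1 x1'] x2.
set e0 := volatility z * x (s + 0%:Z).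
set v1 := volatility (e0, z.1).
have e0_ge : omega <= e0 ^+ 2.
  by rewrite exprMn addr0 (le_trans (volatility_sqr_ge z))// ler_peMr// sqr_ge0.
have a1_gt0 : 0 < 1 + alpha by rewrite ltr_wpDr.
have c_gt0 : 0 < c by rewrite divr_gt0.
have kE : k = c * (1 + alpha) by rewrite /c divfK// gt_eqF.
(* First reset: [omega <= e0 ^+ 2] turns the bound on [v1 ^+ 2] into [(1 + alpha) * e0 ^+ 2], and
   multiplying by [c] gives [k * e0 ^+ 2]. *)
have -> : volatility (v1 * x (s + 1%:Z), e0) = Num.sqrt omega.
  apply: volatility_reset => /=.
  have v1_le : v1 ^+ 2 <= omega + alpha * e0 ^+ 2 := volatility_sqr_le _.
  rewrite exprMn (le_trans (ler_wpM2r (sqr_ge0 _) v1_le))//.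
  apply: (@le_trans _ _ ((1 + alpha) * e0 ^+ 2 * c)); last by rewrite kE; lra.
  apply: ler_pM => //; rewrite ?sqr_ge0 ?mulrDl ?mul1r ?lerD2r//.
  by exact: addr_ge0 (ltW omega_gt0) (mulr_ge0 alpha_ge0 (sqr_ge0 _)).
(* Second reset: the volatility is now exactly [Num.sqrt omega], and the lower bounds [omega] on
   [v1 ^+ 2] and [c / 2] on [x (s + 1) ^+ 2] match the bound [k * c / 2] on [x (s + 2) ^+ 2]. *)
congr (_, _); congr (_ * _); apply: volatility_reset => /=.
rewrite !exprMn sqr_sqrtr ?(ltW omega_gt0)//.
have v1_ge : omega <= v1 ^+ 2 := volatility_sqr_ge _.
apply: (@le_trans _ _ (omega * (k * c / 2))).
  by rewrite ler_wpM2l ?(ltW omega_gt0).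
apply: (@le_trans _ _ (k * (omega * (c / 2)))); first by lra.
rewrite ler_wpM2l ?(ltW k_gt0)//; apply: ler_pM => //.
- exact: ltW.
- by rewrite divr_ge0 ?(ltW c_gt0).
Qed.

(** Coupling: both runs pass through the renewal, which erases their starting times and states; from
    there on they read the same innovations. *)
Lemma run_renewed x s s' z z' n n' : s + n%:Z = s' + n'%:Z ->
  renewed x (Order.max s s') (s + n%:Z) -> run x s z n = run x s' z' n'.
Proof.
move=> ee [a [+ an fa]]; rewrite ge_max => /andP[sa s'a].
have [p ap] : exists p : nat, a = s + p%:Z by exists `|a - s|%N; lia.
have [p' ap'] : exists p' : nat, a = s' + p'%:Z by exists `|a - s'|%N; lia.
have [q nE] : exists q : nat, n = (p + (4 + q))%N.
  by exists (n - (p + 4))%N; lia.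
have -> : n' = (p' + (4 + q))%N by lia.
rewrite nE runD -ap runD run_forgetful//.
by rewrite runD -ap' runD run_forgetful.
Qed.

(** All runs started at or before [s] agree by [run_renewed], so the sequence is eventually constant
    and the limsup in [stationary] is a true limit. *)
Lemma cvg_stationary x s t : renewed x s (t + 1) ->
  (fun n : nat => (run x (t + 1 - n%:Z) (0, 0) n).1) @ \oo --> stationary x t.
Proof.
move=> rx.
have [n0 sn0] : exists n0 : nat, t + 1 <= s + n0%:Z.
  by exists `|(t + 1 - s)%R|%N; lia.
pose l := (run x (t + 1 - n0%:Z) (0, 0) n0).1.
have ul n : (n0 <= n)%N -> (run x (t + 1 - n%:Z) (0, 0) n).1 = l.
  move=> n0n; congr (_.1); apply: run_renewed; first by lia.
  rewrite subrK; apply: renewedS rx; rewrite ge_max; lia.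
have nl : \forall n \near \oo, (run x (t + 1 - n%:Z) (0, 0) n).1 = l.
  by exists n0 => // n /= /ul.
suff -> : stationary x t = l by apply: cvg_near_cst.
rewrite /stationary (_ : limn_esup _ = l%:E)//.
apply: (@cvg_limn_einf_sup _ _ _ _).2.
apply: cvg_near_cst; near=> n; congr EFin; near: n; exact: nl.
Unshelve. all: by end_near. Qed.

Lemma stationaryE x s t z n : s + n%:Z = t + 1 -> renewed x s (t + 1) ->
  stationary x t = (run x s z n).1.
Proof.
move=> snt rx; have := cvg_stationary rx.
move=> /cvg_lim <-//; apply: lim_near_cst => //.
exists n => // m /= nm; congr (_.1); apply: run_renewed; first by lia.
rewrite subrK; apply: renewedS rx; rewrite ge_max; lia.
Qed.

Lemma stationary_eq x t : (forall u, exists s, renewed x s u) ->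
  stationary x t =
  volatility (stationary x (t - 1), stationary x (t - 2)) * x t.
Proof.
(* A renewal before [t - 1] serves the times [t], [t - 1] and [t - 2] at once: their values are then
   read off one and the same run. *)
move=> /(_ (t - 1)) [s [a [sa at_ fa]]].
have rx u : t - 1 <= u -> renewed x s u.
  by move=> tu; exists a; split => //; lia.
have [n sn] : exists n : nat, s + n.+3%:Z = t + 1.
  by exists `|(t + 1 - s - 3)%R|%N; lia.
rewrite (@stationaryE x s t (0, 0) n.+3)//; last by apply: rx; lia.
rewrite (@stationaryE x s (t - 1) (0, 0) n.+2)//; [|lia|by apply: rx; lia].
rewrite (@stationaryE x s (t - 2) (0, 0) n.+1)//; [|lia|by apply: rx; lia].
rewrite [in LHS]/run -/(run x s (0, 0) n.+1) /=.
by congr (_ * x _); lia.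
Qed.

End recursion.

(** * Measurability of the recursion and of the renewal events *)

Section measurability_of_the_recursion.
Context (R : realType) (omega alpha k : R).

Lemma measurable_volatility :
  measurable_fun [set: R * R] (volatility omega alpha k).
Proof.
apply: (measurableT_comp (continuous_measurable_fun (@sqrt_continuous R))).
apply: measurable_funD => //; apply: measurable_funM.
  by apply: measurable_funM => //; exact: measurable_funX.
rewrite (_ : (fun _ => _) =
  fun z : R * R => if z.1 ^+ 2 > k * z.2 ^+ 2 then 1 else 0 : R).
  apply: measurable_fun_ifT => //; apply: measurable_fun_ltr.
    by apply: measurable_funM => //; exact: measurable_funX.
  exact: measurable_funX.
by apply/funext => z; case: ifP.
Qed.

(** The measurable space is arbitrary and only the innovations that are read must be measurable;
    taking for [T] the sigma-algebra generated by some innovations shows on which of them the run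
    depends. *)
Lemma measurable_run d (T : measurableType d) (X : int -> T -> R) s z n :
  (forall i : nat, (i < n)%N -> measurable_fun [set: T] (X (s + i%:Z))) ->
  measurable_fun [set: T] (fun w => run omega alpha k (X^~ w) s z n).
Proof.
elim: n => [_|n IHn mX] /=; first exact: measurable_cst.
have {}IHn : measurable_fun [set: T]
    (fun w => run omega alpha k (X^~ w) s z n).
  by apply: IHn => i iN; apply: mX; exact: leqW.
apply: measurable_fun_pair.
  apply: measurable_funM; last exact: mX.
  exact: measurableT_comp measurable_volatility IHn.
exact: measurableT_comp measurable_fst IHn.
Qed.

Lemma measurable_stationary d (T : measurableType d) (X : int -> T -> R) t :
  (forall s, s <= t -> measurable_fun [set: T] (X s)) ->
  measurable_fun [set: T] (fun w => stationary omega alpha k (X^~ w) t).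
Proof.
move=> mX; apply: measurableT_comp => //.
apply: measurable_fun_limn_esup => n.
apply/measurable_EFinP; apply: measurableT_comp measurable_fst _.
by apply: measurable_run => i iN; apply: mX; lia.
Qed.

Lemma measurable_forgetful_set i : measurable (forgetful_set alpha k i).
Proof.
have msq : measurable_fun [set: R] (fun y => y ^+ 2) by exact: measurable_funX.
have m2 a b : measurable [set y : R | a <= y ^+ 2 <= b].
  rewrite (_ : [set _ | _] = (fun y : R => y ^+ 2) @^-1` `[a, b]).
    by rewrite -[X in measurable X]setTI; exact: msq.
  by apply/seteqP; split => y /=; rewrite in_itv.
case: i => [|[|i]] //=.
- rewrite (_ : [set _ | _] = (fun y : R => y ^+ 2) @^-1` `[1, +oo[).
    by rewrite -[X in measurable X]setTI; exact: msq.
  by apply/seteqP; split => y /=; rewrite in_itv /= andbT.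
- rewrite (_ : [set _ | _] =
    (fun y : R => y ^+ 2) @^-1` `]-oo, k * (k / (1 + alpha)) / 2]).
    by rewrite -[X in measurable X]setTI; exact: msq.
  by apply/seteqP; split => y /=; rewrite in_itv.
Qed.

Lemma measurable_forgetful d (T : measurableType d) (X : int -> T -> R) a :
  (forall i : nat, (i < 3)%N -> measurable_fun [set: T] (X (a + i%:Z))) ->
  measurable [set w | forgetful alpha k (X^~ w) a].
Proof.
move=> mX.
rewrite (_ : [set _ | _] = X (a + 0%:Z) @^-1` forgetful_set alpha k 0 `&`
  (X (a + 1%:Z) @^-1` forgetful_set alpha k 1 `&`
  X (a + 2%:Z) @^-1` forgetful_set alpha k 2)); last first.
  by rewrite addr0; apply/seteqP; split => w /= [] // ? [].
have mXS i : (i < 3)%N ->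
    measurable (X (a + i%:Z) @^-1` forgetful_set alpha k i).
  move=> i3; rewrite -[X in measurable X]setTI.
  by apply: mX => //; exact: measurable_forgetful_set.
by apply: measurableI; [|apply: measurableI]; exact: mXS.
Qed.

Lemma measurable_renewed d (T : measurableType d) (X : int -> T -> R) s t :
  (forall u, s <= u -> u < t -> measurable_fun [set: T] (X u)) ->
  measurable [set w | renewed alpha k (X^~ w) s t].
Proof.
move=> mX.
rewrite (_ : [set _ | _] = \bigcup_(n in [set n : nat | s + n%:Z + 4 <= t])
  [set w | forgetful alpha k (X^~ w) (s + n%:Z)]); last first.
  apply/seteqP; split => w [] /=.
    move=> a [sa at_ fa]; have na : s + `|a - s|%N%:Z = a by lia.
    by exists `|a - s|%N => /=; rewrite na.
  by move=> n /= sn fn; exists (s + n%:Z); split => //; lia.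
apply: bigcup_measurable => n /= sn.
by apply: measurable_forgetful => i i3; apply: mX; lia.
Qed.

End measurability_of_the_recursion.

(** * Independence *)

(** Dynkin's pi-lambda theorem, behind the extensions from cylinders to generated sigma-algebras
    below. *)
Lemma g_sigma_algebra_sub_dynkin (T : Type) (G H : set (set T)) :
  setI_closed G -> dynkin H -> G `<=` H -> <<s G >> `<=` H.
Proof.
move=> GI dH GH; rewrite -setI_closed_g_dynkin_g_sigma_algebra//.
exact: smallest_sub.
Qed.

Section independence.
Context d (T : measurableType d) (R : realType) (P : probability T R).

Let PE A : measurable A -> P A = (fine (P A))%:E.
Proof. by move=> mA; rewrite fineK// fin_num_measure. Qed.

(** The events independent of a fixed [B] form a Dynkin system. *)
Lemma independent_sigma_algebra1 (G : set (set T)) (B : set T) :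
  setI_closed G -> G `<=` measurable -> measurable B ->
  (forall A, G A -> P (A `&` B) = P A * P B)%E ->
  forall A, <<s G >> A -> P (A `&` B) = (P A * P B)%E.
Proof.
move=> GI mG mB GB.
suff sGH : <<s G >> `<=`
    [set A | measurable A /\ P (A `&` B) = (P A * P B)%E].
  by move=> A /sGH[].
apply: g_sigma_algebra_sub_dynkin => //; first split.
- by split=> //; rewrite setTI probability_setT mul1e.
- move=> A [mA PA]; split; first exact: measurableC.
  rewrite [~` A `&` B]setIC -setDE measureD//; last first.
    by rewrite ltey_eq fin_num_measure.
  transitivity (P B - P A * P B)%E; first by rewrite -PA setIC.
  rewrite probability_setC// (PE mA) (PE mB) -EFinM -!EFinB -EFinM; congr EFin.
  by rewrite mulrBl mul1r.
- move=> F tF mPF.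
  have mF n : measurable (F n) by have [] := mPF n.
  have mUF : measurable (\bigcup_n F n) by exact: bigcup_measurable.
  split => //; rewrite setI_bigcupl.
  rewrite !measure_semi_bigcup//.
  + rewrite (PE mB) muleC -nneseriesZl//.
    apply: eq_eseriesr => n _; rewrite -(PE mB) muleC.
    exact: (mPF n).2.
  + by move=> n; exact: measurableI.
  + by apply: trivIset_setIr.
  + by apply: bigcup_measurable => n _; exact: measurableI.
- by move=> A GA; split; [exact: mG|exact: GB].
Qed.

(** The one-sided extension is applied twice, once in each argument. *)
Lemma independent_sigma_algebra (G1 G2 : set (set T)) :
  setI_closed G1 -> setI_closed G2 ->
  G1 `<=` measurable -> G2 `<=` measurable ->
  (forall A B, G1 A -> G2 B -> P (A `&` B) = P A * P B)%E ->
  forall A B, <<s G1 >> A -> <<s G2 >> B -> P (A `&` B) = (P A * P B)%E.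
Proof.
move=> G1I G2I mG1 mG2 G12 A B sA sB.
apply: (independent_sigma_algebra1 G1I) => //.
  by move: sB; apply: smallest_sub => //; exact: sigma_algebra_measurable.
move=> {sA}A GA; rewrite setIC muleC.
apply: (independent_sigma_algebra1 G2I) => //; first exact: mG1.
by move=> {sB}B GB; rewrite setIC muleC G12.
Qed.

End independence.

(** * Cylinder events and independence over disjoint sets of times *)

Section cylinders.
Context (T : Type) (R : realType).
Implicit Types (X : int -> T -> R) (S : set int).

Definition cylinders X S : set (set T) :=
  [set C | exists s (A : int -> set R),
    [/\ uniq s, [set` s] `<=` S, forall t, measurable (A t) &
        C = \bigcap_(t in [set` s]) X t @^-1` A t]].

Lemma setI_closed_cylinders X S : setI_closed (cylinders X S).
Proof.
move=> _ _ [s1 [A1 [u1 s1S mA1 ->]]] [s2 [A2 [u2 s2S mA2 ->]]].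
(* The two lists of times are merged, and each family is padded with [setT] at the times that it
   does not constrain. *)
exists (undup (s1 ++ s2)), (fun t =>
  (if t \in s1 then A1 t else setT) `&` (if t \in s2 then A2 t else setT)).
split=> [||t|].
- exact: undup_uniq.
- by move=> t /=; rewrite mem_undup mem_cat => /orP[/s1S|/s2S].
- by apply: measurableI; case: ifP.
- apply/seteqP; split => [w [w1 w2] t /= _|w wA].
    by split; case: ifPn => // ts; [exact: w1|exact: w2].
  split=> t /= ts; have := wA t; rewrite /= mem_undup mem_cat ts ?orbT;
    by case=> // + +; rewrite ?ts.
Qed.

Lemma cylinder1 X S t (A : set R) : S t -> measurable A ->
  cylinders X S (X t @^-1` A).
Proof.
move=> St mA; exists [:: t], (fun=> A); split => //.
  by move=> u /=; rewrite inE => /eqP ->.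
apply/seteqP; split => [w wA u|w] /=.
  by rewrite inE => /eqP ->.
by apply; rewrite /= inE.
Qed.

End cylinders.

Section independent_process.
Context d (T : measurableType d) (R : realType) (P : probability T R).
Variable X : int -> {RV P >-> R}.

Lemma cylinders_measurable S : cylinders X S `<=` measurable.
Proof.
move=> _ [s [A [_ _ mA ->]]]; apply: fin_bigcap_measurable => // t _.
by rewrite -[X in measurable X]setTI; exact: measurable_funPT.
Qed.

Lemma sigma_process_cylinders S :
  sigma_process X S `<=` <<s cylinders X S >>.
Proof.
apply: smallest_sub; first exact: smallest_sigma_algebra.
move=> _ [t St [A mA <-]]; apply: sub_sigma_algebra.
by rewrite setTI; exact: cylinder1.
Qed.

Lemma sigma_process_measurable S : sigma_process X S `<=` measurable.
Proof.
apply: smallest_sub; first exact: sigma_algebra_measurable.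
by move=> _ [t St [A mA <-]]; exact: measurable_funPT.
Qed.

Hypothesis indepX : mutually_independent X.

Lemma probability_cylinder (s : seq int) (A : int -> set R) : uniq s ->
  (forall t, measurable (A t)) ->
  P (\bigcap_(t in [set` s]) X t @^-1` A t) =
  (\prod_(t <- s) P (X t @^-1` A t))%E.
Proof. by move=> us mA; rewrite bigcap_seq indepX. Qed.

(** Cylinders form a generating pi-system; for two of them over disjoint sets of times, the product
    formula over the concatenated list splits. *)
Lemma independent_sigma_process (S1 S2 : set int) : [disjoint S1 & S2] ->
  forall A B, sigma_process X S1 A -> sigma_process X S2 B ->
  P (A `&` B) = (P A * P B)%E.
Proof.
move=> S12 A B /sigma_process_cylinders sA /sigma_process_cylinders sB.
move: A B sA sB; apply: independent_sigma_algebra;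
  try exact: setI_closed_cylinders; try exact: cylinders_measurable.
move=> _ _ [s1 [A1 [u1 s1S mA1 ->]]] [s2 [A2 [u2 s2S mA2 ->]]].
have s12 t : t \in s2 -> (t \in s1) = false.
  move=> /s2S t2; apply/negP => /s1S t1.
  by move/disj_setPS : S12 => /(_ t); apply.
pose A t := if t \in s1 then A1 t else A2 t.
have <- : \bigcap_(t in [set` s1 ++ s2]) X t @^-1` A t =
    \bigcap_(t in [set` s1]) X t @^-1` A1 t `&`
    \bigcap_(t in [set` s2]) X t @^-1` A2 t.
  rewrite /A; apply/seteqP; split => [w wA|w [w1 w2] t /=].
    split => t /= ts; have := wA t; rewrite /= mem_cat ts ?orbT /=.
      exact.
    by rewrite s12//; apply.
  by rewrite mem_cat; case: ifPn => /= [ts _|_]; [exact: w1|exact: w2].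
rewrite !probability_cylinder//; last 2 first.
- rewrite cat_uniq u1 u2 andbT /=; apply/hasPn => t ts2.
  by rewrite s12.
- by move=> t; rewrite /A; case: ifP.
rewrite big_cat /=; congr (_ * _)%E; apply: eq_big_seq => t ts; rewrite /A.
  by rewrite ts.
by rewrite s12.
Qed.

End independent_process.

(** * Equality in law on the path space *)

Section equality_in_law.
Context d (T : measurableType d) (R : realType) (P : probability T R).

Definition coordinate (t : int) (x : int -> R) : R := x t.

(** Independence makes the marginals determine the probability of every cylinder, hence the law on
    the path space. The intended [Y] is [X] up to a time shift, so one probability space
    suffices. *)
Lemma eq_law_of_independent (X Y : int -> {RV P >-> R}) :
  mutually_independent X -> mutually_independent Y ->
  (forall t (A : set R), measurable A -> P (X t @^-1` A) = P (Y t @^-1` A)) ->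
  forall C, <<s cylinders coordinate setT >> C ->
  P [set w | C (X^~ w)] = P [set w | C (Y^~ w)].
Proof.
move=> iX iY XY.
(* The map sending [w] to its path is measurable into the path space. *)
have mp (Z : int -> {RV P >-> R}) C : <<s cylinders coordinate setT >> C ->
    measurable [set w | C (Z^~ w)].
  suff : measurable_fun [set: T] (fun w => Z^~ w :
      g_sigma_algebraType (cylinders coordinate setT)).
    by move=> + sC => /(_ measurableT C sC); rewrite setTI.
  apply: (@measurability _ _ T
    (g_sigma_algebraType (cylinders coordinate setT)) setT _
    (cylinders coordinate setT)) => //.
  move=> _ [_ [s [A [us sS mA ->]]] <-]; rewrite setTI.
  apply: (@cylinders_measurable _ _ _ P Z setT).
  by exists s, A.
suff sH : <<s cylinders coordinate setT >> `<=`
    [set C | <<s cylinders coordinate setT >> C /\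
             P [set w | C (X^~ w)] = P [set w | C (Y^~ w)]].
  by move=> C /sH[].
have [sC0 sCC sCU] := smallest_sigma_algebra setT (cylinders coordinate setT).
apply: g_sigma_algebra_sub_dynkin; [exact: setI_closed_cylinders|split|].
- by split => //; have := sCC _ sC0; rewrite setD0.
- move=> C [sC XYC]; split; first by have := sCC _ sC; rewrite setTD.
  rewrite (_ : [set w | (~` C) (X^~ w)] = ~` [set w | C (X^~ w)])//.
  rewrite (_ : [set w | (~` C) (Y^~ w)] = ~` [set w | C (Y^~ w)])//.
  by rewrite !probability_setC ?XYC//; exact: mp.
- move=> F tF HF.
  have mF n : <<s cylinders coordinate setT >> (F n) by have [] := HF n.
  split; first exact: sCU.
  have tZ (Z : int -> {RV P >-> R}) :
      trivIset setT (fun n => [set w | F n (Z^~ w)]).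
    apply/trivIsetP => i j _ _ ij; apply/seteqP; split => // w [Fi Fj].
    move/trivIsetP : tF => /(_ i j Logic.I Logic.I ij).
    by move/seteqP => -[/(_ (Z^~ w))] + _; apply.
  have bE (Z : int -> {RV P >-> R}) : [set w | (\bigcup_n F n) (Z^~ w)] =
      \bigcup_n [set w | F n (Z^~ w)] by [].
  rewrite !bE !measure_semi_bigcup//.
  + by apply: eq_eseriesr => n _; have [] := HF n.
  + by move=> n; apply: mp; exact: mF.
  + by apply: bigcup_measurable => n _; apply: mp; exact: mF.
  + by move=> n; apply: mp; exact: mF.
  + by apply: bigcup_measurable => n _; apply: mp; exact: mF.
- move=> _ [s [A [us sS mA ->]]]; split.
    by apply: sub_sigma_algebra; exists s, A.
  rewrite (probability_cylinder iX us mA) (probability_cylinder iY us mA).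
  by apply: eq_bigr => t _; exact: XY.
Qed.

End equality_in_law.

Section product_of_independent.
Local Open Scope ereal_scope.
Context d (T : measurableType d) (R : realType) (P : probability T R).

(** The joint law is the product of the marginal laws, and Tonelli's theorem factors the
    integral. *)
Lemma ge0_integralM_independent (X Y : {RV P >-> R}) :
  (forall w, 0 <= X w)%R -> (forall w, 0 <= Y w)%R ->
  (forall A B, measurable A -> measurable B ->
    P (X @^-1` A `&` Y @^-1` B) = P (X @^-1` A) * P (Y @^-1` B)) ->
  \int[P]_w (X w * Y w)%:E = (\int[P]_w (X w)%:E) * (\int[P]_w (Y w)%:E).
Proof.
move=> X0 Y0 XY.
have mZ : measurable_fun [set: T] (fun w => (X w, Y w)).
  exact: measurable_fun_pair.
pose Z : {RV P >-> (R * R)%type} := mfun_Sub (mem_set mZ).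
(* The absolute values make [f] nonnegative on the whole plane and change nothing on the range of
   [(X, Y)]. *)
pose f (z : R * R) : \bar R := (`|z.1| * `|z.2|)%:E.
have mf : measurable_fun [set: R * R] f.
  apply/measurable_EFinP; apply: measurable_funM;
  by apply: measurableT_comp => //; exact: measurableT_comp.
have f0 z : 0 <= f z by rewrite lee_fin mulr_ge0.
transitivity (\int[distribution P Z]_z f z).
  rewrite ge0_integral_distribution//; apply: eq_integral => w _.
  by rewrite /f /= !ger0_norm.
transitivity (\int[distribution P X \x distribution P Y]_z f z).
  apply: eq_measure_integral => C mC _; symmetry.
  by apply: product_measure_unique => //= A B mA mB; exact: XY.
have mabs : measurable_fun [set: R] (fun x : R => (`|x|)%:E).
  by apply/measurable_EFinP; exact: normr_measurable.
have distE (V : {RV P >-> R}) : (forall w, 0 <= V w)%R ->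
    \int[distribution P V]_x (`|x|)%:E = \int[P]_w (V w)%:E.
  move=> V0; rewrite ge0_integral_distribution//.
  by apply: eq_integral => w _ /=; rewrite ger0_norm.
rewrite fubini_tonelli1// /fubini_F /f /=.
under eq_integral => x _.
  under eq_integral do rewrite EFinM.
  rewrite ge0_integralZl_EFin// distE//.
  over.
have YE : 0 <= \int[P]_w (Y w)%:E.
  by apply: integral_ge0 => w _; rewrite lee_fin.
by rewrite ge0_integralZr// distE.
Qed.

End product_of_independent.

(** * Essential suprema and mixing coefficients *)

Section family_ess_sup_theory.
Local Open Scope ereal_scope.
Context d (T : measurableType d) (R : realType) (P : probability T R).
Variables (S : set (T -> \bar R)) (M : R).
Hypotheses (M0 : (0 <= M)%R) (S0 : S !=set0).
Hypothesis mS : forall h, S h -> measurable_fun [set: T] h.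
Hypothesis S_ge0 : forall h, S h -> forall w, 0 <= h w.
Hypothesis S_le : forall h, S h -> \forall w \ae P, h w <= M%:E.

Let below (g : T -> \bar R) : Prop :=
  [/\ measurable_fun [set: T] g, forall w, 0 <= g w <= M%:E &
      forall u, measurable_fun [set: T] u ->
        (forall h, S h -> \forall w \ae P, h w <= u w) ->
        \forall w \ae P, g w <= u w].

Let below_integrable g : below g -> P.-integrable setT g.
Proof.
move=> [mg gM _].
apply: (@le_integrable _ _ _ _ _ measurableT _ (EFin \o cst M)) => //.
  by move=> w _ /=; have /andP[g0 gle] := gM w; rewrite gee0_abs// ger0_norm.
exact: finite_measure_integrable_cst.
Qed.

Let below_cst0 : below (cst 0).
Proof.
split; [exact: measurable_cst|by move=> w; rewrite lexx lee_fin|].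
move=> u mu Su; have [h Sh] := S0.
by apply: filterS (Su _ Sh) => w; exact: le_trans (S_ge0 Sh w).
Qed.

Let c := ereal_sup [set \int[P]_w g w | g in below].

Let c_fin : c \is a fin_num.
Proof.
have c0 : 0 <= c.
  apply: ereal_sup_ubound; exists (cst 0); first exact: below_cst0.
  by rewrite integral0.
rewrite ge0_fin_numE//; apply: (@le_lt_trans _ _ M%:E); last exact: ltry.
apply: ge_ereal_sup => _ [g bg <-].
apply: (@le_trans _ _ (\int[P]_w cst M%:E w)).
  apply: le_integral => //; first exact: below_integrable.
    exact: (@finite_measure_integrable_cst _ _ _ _ setT M).
  by case: bg => _ gM _ w _; have /andP[] := gM w.
rewrite integral_cst// [X in _ * X](_ : _ = 1) ?mule1//.
exact: probability_setT.
Qed.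

(* Functions that are a.s. below every upper bound of the family are stable
   under countable suprema, so one of them has maximal integral. *)
Lemma ex_family_ess_sup : exists g, is_family_ess_sup P S g.
Proof.
have : forall n : nat, exists g, below g /\
    c - (n.+1%:R^-1)%:E < \int[P]_w g w.
  move=> n; have n0 : (0 < n.+1%:R^-1 :> R)%R by rewrite invr_gt0.
  by have [_ [g bg <-] cg] := ub_ereal_sup_adherent n0 c_fin; exists g.
move=> /choice[u /all_and2[bu cu]].
pose g w := esups (u^~ w) 0%N.
have ug n w : u n w <= g w by apply: ereal_sup_ubound; exists n.
have g_le w y : (forall n, u n w <= y) -> g w <= y.
  by move=> uy; apply: ge_ereal_sup => _ [n _ <-].
have bg : below g.
  split=> [|w|v mv Sv].
  - by apply: measurable_fun_esups => n; have [] := bu n.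
  - apply/andP; split.
      by apply: le_trans (ug 0%N w); have [_ /(_ w) /andP[]] := bu 0%N.
    by apply: g_le => n; have [_ /(_ w) /andP[]] := bu n.
  - have : \forall w \ae P, forall n, u n w <= v w.
      by apply: ae_foralln => n; have [_ _] := bu n; exact.
    by apply: filterS => w; exact: g_le.
have [mg gM gu] := bg.
have cg : c <= \int[P]_w g w.
  apply/lee_addgt0Pr => e e0.
  have [n ne] : exists n : nat, (n.+1%:R^-1 < e)%R.
    have [n] := ltr_add_invr e0; rewrite add0r => ne.
    by exists n.
  rewrite -leeBlDr//; apply: (@le_trans _ _ (c - (n.+1%:R^-1)%:E)).
    by rewrite leeB// lee_fin ltW.
  apply: (le_trans (ltW (cu n))); apply: le_integral => //;
    exact: below_integrable.
exists g; split => // h Sh.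
(* Were [h] to exceed [g] on a non-null set, [m] would be a candidate of larger integral than the
   maximum. Truncating at [M] keeps [m] bounded and is harmless, as [h] is a.s. at most [M]. *)
pose m w := maxe (g w) (mine (h w) M%:E).
have bm : below m.
  split=> [|w|v mv Sv].
  - apply: measurable_maxe => //; apply: measurable_mine => //; exact: mS.
  - have /andP[g0 gM'] := gM w.
    by rewrite /m le_max g0 /= ge_max gM' /= ge_min lexx orbT.
  - apply: filterS2 (gu v mv Sv) (Sv _ Sh) => w gv hv.
    by rewrite /m ge_max gv /= ge_min hv.
have gm w : g w <= m w by rewrite /m le_max lexx.
have [mm mM _] := bm.
have gfin w : g w \is a fin_num.
  have /andP[g0 gw] := gM w.
  by rewrite ge0_fin_numE//; exact: le_lt_trans gw (ltry _).
have : \int[P]_w `|m w - g w| = 0.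
  apply/eqP; rewrite eq_le; apply/andP; split; last exact: integral_ge0.
  under eq_integral => w _ do rewrite gee0_abs ?sube_ge0 ?gfin//.
  rewrite integralB//; try exact: below_integrable.
  rewrite sube_le0; apply: le_trans cg.
  by apply: ereal_sup_ubound; exists m.
have mmg : measurable_fun [set: T] (fun w => m w - g w).
  exact: emeasurable_funB.
move=> /(ae_eq_integral_abs P measurableT mmg) mg0.
apply: filterS2 mg0 (S_le Sh) => w /(_ Logic.I) /= mg0 hM.
have : m w <= g w by rewrite -sube_le0 mg0.
by rewrite /m (min_l hM) ge_max => /andP[].
Qed.

End family_ess_sup_theory.

(** * Mixing coefficients bounded through almost independence *)

Section mixing_coefficients.
Local Open Scope ereal_scope.
Context d (T : measurableType d) (R : realType) (P : probability T R).

Lemma null_of_integral_le0 (mu : {measure set T -> \bar R}) (A : set T)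
    (f : T -> R) : measurable A -> measurable_fun A f ->
  (forall w, A w -> (0 < f w)%R) -> \int[mu]_(w in A) (f w)%:E <= 0 ->
  mu A = 0.
Proof.
move=> mA mf f0 Af.
have : \int[mu]_(w in A) `|(EFin \o f) w| = 0.
  apply/eqP; rewrite eq_le; apply/andP; split; last exact: integral_ge0.
  under eq_integral => w /set_mem Aw.
    rewrite gee0_abs//; last by rewrite lee_fin ltW// f0.
    over.
  exact: Af.
move=> /(ae_eq_integral_abs mu mA (iffRL (measurable_EFinP _ _) mf)).
move=> [N [mN PN AN]].
apply: (subset_measure0 mA mN _ PN) => w Aw; apply: AN => /= /(_ Aw) [fw].
by have := f0 _ Aw; rewrite fw ltxx.
Qed.

Variables (F G : set (set T)) (q : R).
Hypotheses (sF : sigma_algebra setT F) (mF : F `<=` measurable).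
Hypotheses (GT : G setT) (mG : G `<=` measurable).
Hypothesis FG : forall A B, F A -> G B ->
  `|P (A `&` B) - P A * P B| <= q%:E * P A.

Let PE A : measurable A -> P A = (fine (P A))%:E.
Proof. by move=> mA; rewrite fineK// fin_num_measure. Qed.

Let integral_cstP A (r : R) : measurable A ->
  \int[P]_(w in A) r%:E = (r * fine (P A))%:E.
Proof. by move=> mA; rewrite integral_cst// EFinM -PE. Qed.

Let FT : F setT.
Proof. by have [F0 /(_ _ F0)] := sF; rewrite setD0. Qed.

Let q_ge0 : (0 <= q)%R.
Proof.
have := le_trans (abse_ge0 _) (FG FT GT).
by rewrite probability_setT mule1 lee_fin.
Qed.

Lemma alpha_coef_le : alpha_coef P F G <= q%:E.
Proof.
apply: ge_ereal_sup => _ [A [B [FA GB ->]]].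
apply: (le_trans (FG FA GB)); rewrite -[leRHS]mule1.
by apply: lee_wpmul2l; [rewrite lee_fin|exact/probability_le1/mF].
Qed.

(* The conditional probability deviates from P B by more than q only on an
   F-measurable set, to which the hypothesis applies. *)
Lemma cond_prob_version_near B p : G B -> cond_prob_version P F B p ->
  \forall w \ae P, `|(p w)%:E - P B| <= q%:E.
Proof.
move=> GB [Fp Ip intp]; have mB := mG GB.
set b := fine (P B).
(* The sign [s] treats both directions of deviation at once: the integral of [s * (p - b) - q] over
   [A] is [s * (P (A]&[B) - b * P A) - q * P A], which is at most 0 by [FG]. *)
have null (s : R) (A : set T) : F A -> (`|s| = 1)%R ->
    (forall w, A w -> (0 < s * (p w - b) - q)%R) -> P A = 0.
  move=> FA s1 sA; have mA := mF FA.
  have Iq : P.-integrable setT (EFin \o (fun w => s * (p w - b) - q))%R.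
    apply: (@eq_integrable _ _ _ _ _ measurableT
        (fun w => s%:E * (EFin \o p) w - (EFin \o cst (s * b + q)%R) w)).
      by move=> w _ /=; congr EFin; lra.
    apply: integrableB => //; first exact: integrableZl.
    exact: finite_measure_integrable_cst.
  apply: (null_of_integral_le0 mA _ sA).
    apply: measurable_funTS; apply/measurable_EFinP.
    by case/integrableP : Iq.
  under eq_integral => w _.
    rewrite (_ : (_ - _)%R = s * p w - (s * b + q))%R; last by lra.
    rewrite EFinB.
    over.
  rewrite integralB_EFin//; last 2 first.
  - apply: (@integrableS _ _ _ _ setT) => //.
    apply: (@eq_integrable _ _ _ _ _ measurableT
        (fun w => s%:E * (EFin \o p) w)) => //.
    exact: integrableZl.
  - exact: (@finite_measure_integrable_cst _ _ _ _ A (s * b + q)%R).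
  under eq_integral do rewrite EFinM.
  rewrite integralZl//; last exact: (@integrableS _ _ _ _ setT).
  rewrite intp// integral_cstP//.
  have := FG FA GB; have mAB := measurableI _ _ mA mB.
  rewrite (PE mA) (PE mB) (PE mAB) -/b.
  rewrite -!EFinM -!EFinB abse_EFin !lee_fin.
  have : (s = 1 \/ s = -1)%R.
    by move/eqP : s1; rewrite eqr_norml => /andP[/orP[]/eqP-> _]; [left|right].
  by case=> -> /ler_normlP[]; nra.
have FpA Y : measurable Y -> F (p @^-1` Y) by exact: Fp.
have P1 : P (p @^-1` `](b + q)%R, +oo[) = 0.
  apply: (null 1%R); [exact: FpA|by rewrite normr1|move=> w /=].
  by rewrite in_itv /= andbT; lra.
have P2 : P (p @^-1` `]-oo, (b - q)%R[) = 0.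
  apply: (null (-1)%R); [exact: FpA|by rewrite normrN1|move=> w /=].
  by rewrite in_itv /=; lra.
have m1 : measurable (p @^-1` `](b + q)%R, +oo[) by apply: mF; exact: FpA.
have m2 : measurable (p @^-1` `]-oo, (b - q)%R[) by apply: mF; exact: FpA.
exists (p @^-1` `](b + q)%R, +oo[ `|` p @^-1` `]-oo, (b - q)%R[); split.
- exact: measurableU.
- by rewrite measureU0.
- move=> w /= /negP; rewrite (PE mB) -EFinB abse_EFin lee_fin -ltNge lter_normr.
  by rewrite !in_itv /= andbT => /orP[h|h]; [left|right]; rewrite -/b in h; lra.
Qed.

(** The constant [q] is an a.s. upper bound of the family, so the least upper bound is a.s. at most
    [q], and so is its expectation. *)
Lemma beta_coef_le : beta_coef P F G <= q%:E.
Proof.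
rewrite /beta_coef; set S := [set h | _].
have Sae h : S h -> \forall w \ae P, h w <= q%:E.
  by move=> [B [p [GB Bp ->]]]; exact: cond_prob_version_near.
(* The sure event, with the constant version 1, shows that the family is inhabited. *)
have S0 : S !=set0.
  exists (fun w => `|1%:E - P setT|), setT, (cst 1%R); split => //; split.
  - move=> Y _; rewrite preimage_cst; case: ifP => _ //.
    by case: sF.
  - exact: finite_measure_integrable_cst.
  - move=> A FA; rewrite (integral_cstP 1%R (mF FA)) mul1r setIT -PE//.
    exact: mF.
have mS h : S h -> measurable_fun setT h.
  move=> [B [p [GB [Fp _ _] ->]]]; apply: measurableT_comp => //.
  apply: emeasurable_funB => //; apply/measurable_EFinP => _ Y mY.
  by rewrite setTI; apply: mF; exact: Fp.
have S_ge0 h : S h -> forall w, 0 <= h w.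
  by move=> [B [p [_ _ ->]]] w; exact: abse_ge0.
(* Existence excludes the default value of [family_ess_sup]. *)
have [mg Sg gle] : is_family_ess_sup P S (family_ess_sup P S).
  exact: (xgetPex _ (ex_family_ess_sup q_ge0 S0 mS S_ge0 Sae)).
set g := family_ess_sup P S in mg Sg gle *.
have {}gle : \forall w \ae P, g w <= q%:E by exact: gle.
(* The chosen [g] is only determined up to a null set and may take negative values, so its positive
   part is bounded instead. *)
rewrite integralE; apply: (@le_trans _ _ (\int[P]_w g^\+ w)).
  by rewrite -[leRHS]sube0 leeB// integral_ge0.
apply: (@le_trans _ _ (\int[P]_w cst q%:E w)).
  apply: ae_ge0_le_integral => //; first exact: measurable_funepos.
  by apply: filterS gle => w gq _; rewrite funeposE ge_max gq lee_fin.
by rewrite (integral_cstP q measurableT) probability_setT mulr1.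
Qed.

End mixing_coefficients.

(** * Renewals of an i.i.d. sequence of innovations *)

Section renewals.
Context (R : realType) (alpha k : R) (alpha_ge0 : 0 <= alpha) (k_gt0 : 0 < k).
Context d (T : measurableType d) (P : probability T R).
Variables (X : int -> {RV P >-> R}) (f : R -> R).
Hypotheses (indepX : mutually_independent X).
Hypotheses (idX : identically_distributed X).
Hypothesis densX : forall t, square_has_density (X t) f.
Hypothesis f_gt0 : forall x, 0 <= x -> 0 < f x.

(** The generators of [sigma_process X S]: measurability over the space that they generate is
    membership in that sigma-algebra. *)
Definition process_generators (S : set int) : set (set T) :=
  \bigcup_(s in S) preimage_set_system [set: T] (X s) measurable.

Lemma measurable_process_generators (S : set int) t : S t ->
  measurable_fun [set: g_sigma_algebraType (process_generators S)] (X t).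
Proof.
by move=> St _ A mA; apply: sub_sigma_algebra; exists t => //; exists A.
Qed.

Let PE A : measurable A -> P A = (fine (P A))%:E.
Proof. by move=> mA; rewrite fineK// fin_num_measure. Qed.

(** A positive density with zero integral over the interval would make the interval
    Lebesgue-null. *)
Lemma square_itv_gt0 t (a b : R) : 0 <= a -> a < b ->
  (0 < P [set w | `[a, b]%classic (X t w ^+ 2)%R])%E.
Proof.
move=> a0 ab; have [mf densA] := densX t.
rewrite densA// lt0e integral_ge0 ?andbT; last first.
  by move=> x [_]; rewrite /= in_itv /= andbT => /f_gt0 ?; exact: ltW.
have abE : `[a, b]%classic `&` `[0, +oo[%classic = `[a, b]%classic :> set R.
  apply/setIidPl => x; rewrite /= !in_itv /= andbT => /andP[ax _].
  exact: le_trans ax.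
rewrite abE; apply/negP => /eqP If.
have := @null_of_integral_le0 _ _ _ (@lebesgue_measure R) `[a, b]%classic f.
rewrite If lexx => mu0.
have : @lebesgue_measure R `[a, b]%classic = 0%E.
  apply: mu0 => //.
    by apply: measurable_funS mf => //; rewrite -abE; exact: subIsetr.
  move=> x; rewrite /= in_itv /= => /andP[ax _].
  by apply: f_gt0; exact: le_trans ax.
rewrite lebesgue_measure_itv /= lte_fin ab -EFinB => -[] ba.
by move: ab; rewrite -subr_gt0 ba ltxx.
Qed.

(** Each set contains all [y] with [y ^+ 2] in some nondegenerate interval of nonnegative
    numbers. *)
Lemma forgetful_set_gt0 i t :
  (0 < P (X t @^-1` forgetful_set alpha k i))%E.
Proof.
have mXi j : measurable (X t @^-1` forgetful_set alpha k j).
  rewrite -[X in measurable X]setTI.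
  by apply: measurable_funPT => //; exact: measurable_forgetful_set.
have msq (a b : R) : measurable [set w | `[a, b]%classic (X t w ^+ 2)%R].
  rewrite -[X in measurable X]setTI.
  exact: (measurable_funX 2 (@measurable_funPT _ _ _ _ (X t))).
have c_gt0 : 0 < k / (1 + alpha) by rewrite divr_gt0// ltr_wpDr.
have sub (a b : R) j : 0 <= a -> a < b ->
    (forall y : R, a <= y ^+ 2 <= b -> forgetful_set alpha k j y) ->
    (0 < P (X t @^-1` forgetful_set alpha k j))%E.
  move=> a0 ab abj; apply: (lt_le_trans (square_itv_gt0 t a0 ab)).
  apply: le_measure; rewrite ?inE//; try exact: mXi.
  by move=> w /=; rewrite in_itv; exact: abj.
case: i => [|[|i]].
- by apply: (@sub 1 2) => //; [rewrite ltr1n|move=> y /andP[]].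
- apply: (@sub (k / (1 + alpha) / 2) (k / (1 + alpha))) => //; first by lra.
  by lra.
- have ck : 0 < k * (k / (1 + alpha)) / 2 by rewrite divr_gt0// mulr_gt0.
  by apply: (@sub 0 (k * (k / (1 + alpha)) / 2) i.+2) => // y /andP[].
Qed.

Lemma measurable_fun_process t : measurable_fun [set: T] (X t).
Proof. exact: measurable_funPT. Qed.
Hint Resolve measurable_fun_process : core.

Let delta := fine (P [set w | forgetful alpha k (X^~ w) 0]).

Let m_forgetful a : measurable [set w | forgetful alpha k (X^~ w) a].
Proof. exact: measurable_forgetful. Qed.

Let forgetfulE a : P [set w | forgetful alpha k (X^~ w) a] =
  (\prod_(i < 3) P (X 0 @^-1` forgetful_set alpha k i))%E.
Proof.
have a0 : `|a - a|%N = 0%N by lia.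
have a1 : `|(a + 1 - a)%R|%N = 1%N by lia.
have a2 : `|(a + 2 - a)%R|%N = 2%N by lia.
have us : uniq [:: a; a + 1; a + 2].
  by rewrite /= !inE; apply/and3P; split => //; lia.
(* Written as a cylinder over the times [a], [a + 1], [a + 2], the distance to [a] selecting the
   set. *)
have -> : [set w | forgetful alpha k (X^~ w) a] =
    \bigcap_(t in [set` [:: a; a + 1; a + 2]])
      X t @^-1` forgetful_set alpha k `|t - a|%N.
  apply/seteqP; split => w /=.
    by case=> h0 h1 h2 t; rewrite /= !inE => /or3P[]/eqP ->;
      rewrite ?a0 ?a1 ?a2.
  move=> h; split.
  - by have := h a; rewrite /= !inE eqxx a0; apply.
  - by have := h (a + 1); rewrite /= !inE eqxx orbT a1; apply.
  - by have := h (a + 2); rewrite /= !inE eqxx !orbT a2; apply.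
rewrite probability_cylinder//; last first.
  by move=> t; exact: measurable_forgetful_set.
rewrite !big_cons big_nil !big_ord_recl big_ord0.
have PX t i : P (X t @^-1` forgetful_set alpha k i) =
    P (X 0 @^-1` forgetful_set alpha k i).
  by apply: idX; exact: measurable_forgetful_set.
by rewrite (PX a) (PX (a + 1)) (PX (a + 2)) a0 a1 a2.
Qed.

Lemma forgetful_probability a :
  P [set w | forgetful alpha k (X^~ w) a] = delta%:E.
Proof. by rewrite /delta -PE// !forgetfulE. Qed.

Lemma forgetful_probability_gt0 : 0 < delta.
Proof.
rewrite -lte_fin -(forgetful_probability 0) forgetfulE.
by rewrite !big_ord_recl big_ord0 mule1 !mule_gt0// forgetful_set_gt0.
Qed.

Lemma forgetful_probability_le1 : delta <= 1.
Proof.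
by rewrite -lee_fin -(forgetful_probability 0) probability_le1.
Qed.

(** The attempts start four steps apart: they read disjoint blocks of innovations, hence are
    independent, and each success is a renewal within its own block. *)
Let unforgetful s n :=
  [set w | forall j, (j < n)%N ->
           ~ forgetful alpha k (X^~ w) (s + (4 * j)%N%:Z)].

Let sigma_forgetful (S : set int) a :
  (forall i : nat, (i < 3)%N -> S (a + i%:Z)) ->
  sigma_process X S [set w | forgetful alpha k (X^~ w) a].
Proof.
move=> Sa.
apply: (@measurable_forgetful _ _ _ _
  (g_sigma_algebraType (process_generators S)) X) => i i3.
by apply: measurable_process_generators; exact: Sa.
Qed.

Let sigma_unforgetful s n :
  sigma_process X [set t | t < s + (4 * n)%N%:Z] (unforgetful s n).
Proof.
rewrite (_ : unforgetful s n = \bigcap_(j in [set j | (j < n)%N])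
  (~` [set w | forgetful alpha k (X^~ w) (s + (4 * j)%N%:Z)])); last first.
  by apply/seteqP; split => w.
apply: (@bigcap_measurableType _ (g_sigma_algebraType
  (process_generators [set t | t < s + (4 * n)%N%:Z]))) => j /= jn.
apply: measurableC; apply: sigma_forgetful => i i3 /=; lia.
Qed.

Let unforgetful_probability s n :
  P (unforgetful s n) = ((1 - delta) ^+ n)%:E.
Proof.
elim: n => [|n IHn].
  rewrite (_ : unforgetful s 0 = setT) ?probability_setT//.
  by apply/seteqP; split.
rewrite (_ : unforgetful s n.+1 = unforgetful s n `&`
    ~` [set w | forgetful alpha k (X^~ w) (s + (4 * n)%N%:Z)]); last first.
  apply/seteqP; split => w; rewrite /unforgetful /=.
    by move=> h; split=> [j jn|]; apply: h => //; exact: leqW.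
  by move=> [h hn] j; rewrite ltnS leq_eqVlt => /orP[/eqP ->|/h].
(* The first [n] blocks lie before time [s + 4 * n], the next one from that time on. *)
rewrite (independent_sigma_process indepX (S1 := [set t | t < s + (4 * n)%N%:Z])
  (S2 := [set t | s + (4 * n)%N%:Z <= t])).
- by rewrite IHn probability_setC// forgetful_probability -EFinB -EFinM -exprSr.
- by apply/disj_setPS => t /= [lt_t le_t]; move: lt_t; rewrite ltNge le_t.
- exact: sigma_unforgetful.
- apply: (@measurableC _ (g_sigma_algebraType
    (process_generators [set t | s + (4 * n)%N%:Z <= t]))).
  by apply: sigma_forgetful => i i3 /=; lia.
Qed.

Lemma measurable_renewed_process s t :
  measurable [set w | renewed alpha k (X^~ w) s t].
Proof. exact: measurable_renewed. Qed.

(** A window of [n] steps holds [n %/ 4] complete blocks, and without a renewal all of them fail. *)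
Lemma not_renewed_probability_le s t (n : nat) : s + n%:Z <= t ->
  (P (~` [set w | renewed alpha k (X^~ w) s t]) <=
   ((1 - delta) ^+ (n %/ 4))%:E)%E.
Proof.
move=> snt; rewrite -(unforgetful_probability s).
apply: le_measure; rewrite ?inE.
- exact/measurableC/measurable_renewed_process.
- by apply: sigma_process_measurable; exact: sigma_unforgetful.
- move=> w /= nr j jn fj; apply: nr; exists (s + (4 * j)%N%:Z); split => //.
    by lia.
  by have := leq_trunc_div n 4; lia.
Qed.

(** For fixed [u], the probability of no renewal within the last [4 * n] steps is at most
    [(1 - delta) ^+ n], which tends to 0. *)
Lemma ae_renewed :
  \forall w \ae P, forall u, exists s, renewed alpha k (X^~ w) s u.
Proof.
have ae_u u : \forall w \ae P, exists s, renewed alpha k (X^~ w) s u.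
  pose N := \bigcap_n (~` [set w | renewed alpha k (X^~ w) (u - n%:Z) u]).
  have mN : measurable N.
    apply: bigcap_measurableType => n _.
    exact/measurableC/measurable_renewed_process.
  exists N; split => //.
    apply/eqP; rewrite eq_le measure_ge0 andbT.
    apply/lee_addgt0Pr => e e0; rewrite add0e.
    have d1 : `|1 - delta| < 1.
      by rewrite ger0_norm ?subr_ge0 ?forgetful_probability_le1// ltrBlDr
        ltrDl forgetful_probability_gt0.
    have /cvgrPdist_lt /(_ _ e0) [n _ /(_ n (leqnn _))] :=
      cvg_expr d1.
    rewrite sub0r normrN => dn.
    apply: (@le_trans _ _ (P (~` [set w | renewed alpha k (X^~ w)
        (u - (4 * n)%N%:Z) u]))).
      apply: le_measure; rewrite ?inE//.
        exact/measurableC/measurable_renewed_process.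
      exact: bigcap_inf.
    apply: (le_trans (@not_renewed_probability_le _ _ (4 * n)%N _)).
      by rewrite subrK.
    rewrite mulKn// lee_fin (le_trans (ler_norm _))//.
    exact: ltW.
  move=> w /= nr n _ /= rn; apply: nr; by exists (u - n%:Z).
(* A renewal before some time is also one before every later time, so the times [- n] suffice, and
   the null sets are indexed by [nat]. *)
have : \forall w \ae P, forall n : nat,
    exists s, renewed alpha k (X^~ w) s (- n%:Z).
  by apply: ae_foralln => n; exact: ae_u.
apply: filterS => w nr u; have [s [a [sa au fa]]] := nr `|u|%N.
by exists s, a; split => //; lia.
Qed.

End renewals.

(** * The stationary solution *)

Section stationary_process.
Context (R : realType) (omega alpha k : R).
Hypotheses (omega_gt0 : 0 < omega) (alpha_ge0 : 0 <= alpha) (k_gt0 : 0 < k).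
Context d (T : measurableType d) (P : probability T R).
Variables (X : int -> {RV P >-> R}).

Lemma measurable_stationary_process t :
  measurable_fun [set: T] (fun w => stationary omega alpha k (X^~ w) t).
Proof. by apply: measurable_stationary => s _; exact: measurable_funPT. Qed.

Definition stationary_process t : {RV P >-> R} :=
  mfun_Sub (mem_set (measurable_stationary_process t)).

Lemma measurable_volatility_process t : measurable_fun [set: T]
  (fun w => volatility omega alpha k
    (stationary_process (t - 1) w, stationary_process (t - 2) w)).
Proof.
apply: (measurableT_comp (measurable_volatility omega alpha k)).
by apply: measurable_fun_pair; exact: measurable_funPT.
Qed.

Definition volatility_process t : {RV P >-> R} :=
  mfun_Sub (mem_set (measurable_volatility_process t)).

(** Causality: the value at time [t] is a function of the innovations up to [t]. *)
Lemma sigma_stationary_process (S S' : set int) :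
  (forall s t, S t -> s <= t -> S' s) ->
  sigma_process stationary_process S `<=` sigma_process X S'.
Proof.
move=> SS'; apply: smallest_sub; first exact: smallest_sigma_algebra.
move=> _ [t St [A mA <-]].
apply: (@measurable_stationary _ omega alpha k _
  (g_sigma_algebraType (process_generators X S')) X) => // s st.
by apply: measurable_process_generators; exact: SS' st.
Qed.

(* After a renewal the process only depends on the innovations from time 1 on,
   so up to the event of no renewal its future is independent of the past. *)
Lemma sigma_stationary_process_renewed (n : nat) B :
  sigma_process stationary_process [set s | n%:Z <= s] B ->
  exists2 B', sigma_process X [set s | 1 <= s] B' &
    B `&` [set w | renewed alpha k (X^~ w) 1 (n%:Z + 1)] =
    B' `&` [set w | renewed alpha k (X^~ w) 1 (n%:Z + 1)].
Proof.
set S1 := [set s | 1 <= s].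
set N := [set w | renewed alpha k (X^~ w) 1 (n%:Z + 1)].
have [s0 sC sU] : sigma_algebra setT (sigma_process X S1).
  exact: smallest_sigma_algebra.
suff : sigma_process stationary_process [set s | n%:Z <= s] `<=`
    [set B | exists2 B', sigma_process X S1 B' & B `&` N = B' `&` N].
  by apply.
(* The events having the same trace on [N] as some event of [sigma_process X S1] form a
   sigma-algebra, so generators suffice. *)
apply: smallest_sub.
  split=> [|A [A' sA' AA']|F sF].
  - by exists set0.
  - exists (~` A'); first by have := sC _ sA'; rewrite setTD.
    rewrite setTD.
    apply/seteqP; split => w [/= wA Nw]; split => //= wA'.
      have : (A' `&` N) w by [].
      by rewrite -AA' => -[/wA].
    have : (A `&` N) w by [].
    by rewrite AA' => -[].
  - have /choice[F' sF'] : forall i, exists B',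
        sigma_process X S1 B' /\ F i `&` N = B' `&` N.
      by move=> i; have [B' ? ?] := sF i; exists B'.
    exists (\bigcup_i F' i); first by apply: sU => i; exact: (sF' i).1.
    by rewrite !setI_bigcupl; apply: eq_bigcupr => i _; exact: (sF' i).2.
move=> _ [t /= nt [A mA <-]].
have [m tm] : exists m : nat, t = m%:Z by exists `|t|%N; lia.
(* On [N] any run from time 1 gives the value at time [t = m]; the state [(0, 0)] is arbitrary. *)
pose Z w := (run omega alpha k (X^~ w) 1 (0, 0) m).1.
exists (Z @^-1` A).
  have : measurable_fun [set: g_sigma_algebraType (process_generators X S1)] Z.
    apply: (measurableT_comp measurable_fst).
    apply: measurable_run => i im; apply: measurable_process_generators.
    by rewrite /S1 /=; lia.
  by move=> /(_ measurableT A mA); rewrite setTI.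
have ZE w : N w -> stationary omega alpha k (X^~ w) t = Z w.
  move=> Nw; rewrite /Z.
  apply: (@stationaryE _ _ _ _ omega_gt0 alpha_ge0 k_gt0 _ 1); first by lia.
  by move: Nw; rewrite /N /= => -[a [? ? ?]]; exists a; split => //; lia.
rewrite setTI; apply/seteqP; split => w [Aw Nw]; split => //.
  by rewrite /preimage/= -ZE.
by rewrite /preimage/= ZE.
Qed.

Lemma sigma_process_sigma_algebra (Y : int -> {RV P >-> R}) S :
  sigma_algebra setT (sigma_process Y S).
Proof. exact: smallest_sigma_algebra. Qed.

Hypothesis indepX : mutually_independent X.

Let PE A : measurable A -> P A = (fine (P A))%:E.
Proof. by move=> mA; rewrite fineK// fin_num_measure. Qed.

(** [A] is exactly independent of [B']. Replacing [B] by [B'] costs at most [P A * q] in [P (A]&[B)]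
    and again in [P A * P B], hence the factor 2. *)
Lemma stationary_process_almost_independent (n : nat) (q : R) A B :
  (P (~` [set w | renewed alpha k (X^~ w) 1 (n%:Z + 1)]) <= q%:E)%E ->
  sigma_process stationary_process [set s | s <= 0] A ->
  sigma_process stationary_process [set s | n%:Z <= s] B ->
  (`|P (A `&` B) - P A * P B| <= (2 * q)%:E * P A)%E.
Proof.
set N := [set w | renewed alpha k (X^~ w) 1 (n%:Z + 1)] => Nq sA sB.
have mB : measurable B by apply: sigma_process_measurable sB.
have {}sA : sigma_process X [set s | s <= 0] A.
  by move: sA; apply: sigma_stationary_process => s t /= ? ?; lia.
have [B' sB' BB'] := sigma_stationary_process_renewed sB.
rewrite -/N in BB'.
have mA : measurable A by apply: sigma_process_measurable sA.
have mB' : measurable B' by apply: sigma_process_measurable sB'.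
(* The absence of a renewal is also independent of [A]; this puts the factor [P A] into the error,
   as the bound on the beta coefficient requires. *)
have sN : sigma_process X [set s | 1 <= s] (~` N).
  apply: (@measurableC _ (g_sigma_algebraType
    (process_generators X [set s | 1 <= s]))).
  apply: (@measurable_renewed _ _ _ _ (g_sigma_algebraType
    (process_generators X [set s | 1 <= s])) X) => u u1 _.
  exact: measurable_process_generators.
have mN : measurable (~` N) by apply: sigma_process_measurable sN.
have S12 : [disjoint [set s : int | s <= 0] & [set s | 1 <= s]].
  by apply/disj_setPS => t /= [? ?]; lia.
have indep := independent_sigma_process indepX S12 sA.
have close U V W : measurable U -> measurable V -> measurable W ->
    U `<=` V `|` W -> fine (P U) <= fine (P V) + fine (P W).
  move=> mU mV mW UVW; rewrite -lee_fin EFinD -!PE//.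
  apply: le_trans (measureU2 _ mV mW).
  by apply: le_measure; rewrite ?inE//; exact: measurableU.
have BN w : N w -> (B w <-> B' w).
  by move=> Nw; split=> Bw; [have : (B `&` N) w by []; rewrite BB' => -[]|
    have : (B' `&` N) w by []; rewrite -BB' => -[]].
have mAB := measurableI _ _ mA mB; have mAB' := measurableI _ _ mA mB'.
have mAN := measurableI _ _ mA mN.
have h1 : fine (P (A `&` B)) <= fine (P (A `&` B')) + fine (P (A `&` ~` N)).
  apply: close => // w [Aw Bw]; have [Nw|Nw] := pselect (N w); last by right.
  by left; split => //; exact/(BN _ Nw).
have h2 : fine (P (A `&` B')) <= fine (P (A `&` B)) + fine (P (A `&` ~` N)).
  apply: close => // w [Aw Bw]; have [Nw|Nw] := pselect (N w); last by right.
  by left; split => //; exact/(BN _ Nw).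
have h3 : fine (P B) <= fine (P B') + fine (P (~` N)).
  apply: close => // w Bw; have [Nw|Nw] := pselect (N w); last by right.
  by left; exact/(BN _ Nw).
have h4 : fine (P B') <= fine (P B) + fine (P (~` N)).
  apply: close => // w Bw; have [Nw|Nw] := pselect (N w); last by right.
  by left; exact/(BN _ Nw).
have ABE : fine (P (A `&` B')) = fine (P A) * fine (P B').
  by rewrite indep// fineM// fin_num_measure.
have ANE : fine (P (A `&` ~` N)) = fine (P A) * fine (P (~` N)).
  by rewrite indep// fineM// fin_num_measure.
have a0 : 0 <= fine (P A) by exact: fine_ge0.
have {}Nq : fine (P (~` N)) <= q by rewrite -lee_fin -PE.
have h5 := ler_wpM2l a0 h3; have h6 := ler_wpM2l a0 h4.
have h7 := ler_wpM2l a0 Nq.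
rewrite (PE mAB) (PE mA) (PE mB) -!EFinM -!EFinB abse_EFin lee_fin.
by apply/ler_normlP; rewrite ABE ANE in h1 h2; split; lra.
Qed.

End stationary_process.

(** * Moments *)

Section moments.
Context (R : realType) (omega alpha k : R).
Hypotheses (omega_gt0 : 0 < omega) (alpha_ge0 : 0 <= alpha) (k_gt0 : 0 < k).

(** One step uses [omega + alpha * y ^+ 2 <= (omega + alpha) * (1 + y ^+ 2)]. *)
Lemma run_growth x s (z : R * R) n :
  1 + (run omega alpha k x s z n).1 ^+ 2 <=
  (1 + z.1 ^+ 2) * \prod_(i < n) (1 + (omega + alpha) * x (s + i%:Z) ^+ 2).
Proof.
elim: n => [|n IHn]; first by rewrite big_ord0 mulr1.
have oa : 0 <= omega + alpha by rewrite addr_ge0// ltW.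
rewrite big_ord_recr /= mulrA exprMn.
set y := run _ _ _ _ _ _ _ in IHn *; set b := x _ ^+ 2.
have b0 : 0 <= b by exact: sqr_ge0.
have h : volatility omega alpha k y ^+ 2 * b <=
    (1 + y.1 ^+ 2) * ((omega + alpha) * b).
  rewrite mulrA ler_wpM2r//.
  apply: (le_trans (volatility_sqr_le _ omega_gt0 alpha_ge0 _)).
  rewrite mulrDl mul1r mulrDr [_ ^+ 2 * alpha]mulrC.
  have := mulr_ge0 (sqr_ge0 y.1) (ltW omega_gt0).
  move: (y.1 ^+ 2 * omega) (alpha * _) alpha_ge0 => u v w.
  lra.
have y0 : 0 <= y.1 ^+ 2 by exact: sqr_ge0.
apply: (@le_trans _ _ ((1 + y.1 ^+ 2) * (1 + (omega + alpha) * b))).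
  by rewrite mulrDr mulr1; lra.
by rewrite ler_wpM2r// addr_ge0// mulr_ge0.
Qed.

(** Each factor is at most the sum [S], so the product is at most [S ^+ m], and Bernoulli's
    inequality gives [S <= (1 + S / n) ^+ n]. The bound is affine in the [v i], so its mean only
    involves second moments of the innovations and tends to 1 as [n] grows. *)
Lemma prod_root_le (n m : nat) (v : 'I_m -> R) : (0 < n)%N -> (0 < m)%N ->
  (forall i, 1 <= v i) ->
  (\prod_(i < m) v i) `^ ((m * n)%N%:R^-1) <= 1 + n%:R^-1 * \sum_(i < m) v i.
Proof.
move=> n0 m0 v1; set S := \sum_(i < m) v i.
have v0 i : 0 <= v i by exact: le_trans (v1 i).
have vS i : v i <= S by rewrite /S (bigD1 i)//= lerDl sumr_ge0.
have S0 : 0 <= S by exact: sumr_ge0.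
have Sn0 : 0 <= n%:R^-1 * S by rewrite mulr_ge0// invr_ge0.
have bernoulli (y : R) j : 0 <= y -> 1 + j%:R * y <= (1 + y) ^+ j.
  move=> y0; elim: j => [|j IHj]; first by rewrite mul0r addr0 expr0.
  rewrite exprS; apply: le_trans (ler_wpM2l (addr_ge0 ler01 y0) IHj).
  have jy0 : 0 <= j%:R * (y * y) :> R by rewrite !mulr_ge0.
  by rewrite -natr1; lra.
have S_le : S <= (1 + n%:R^-1 * S) ^+ n.
  apply: le_trans (bernoulli _ n Sn0).
  rewrite mulrA divff ?mul1r ?pnatr_eq0 -?lt0n//.
  by rewrite lerDr.
have mn0 : (m * n)%N%:R != 0 :> R by rewrite pnatr_eq0 -lt0n muln_gt0 m0 n0.
have y1 : 0 <= 1 + n%:R^-1 * S by rewrite addr_ge0.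
have -> : 1 + n%:R^-1 * S =
    ((1 + n%:R^-1 * S) ^+ (m * n)) `^ ((m * n)%N%:R^-1).
  by rewrite -powR_mulrn// -powRrM mulfV// powRr1.
apply: ge0_ler_powR; rewrite ?invr_ge0 ?nnegrE ?prodr_ge0 ?exprn_ge0//.
rewrite mulnC exprM.
apply: (@le_trans _ _ (S ^+ m)); last by rewrite ler_pXn2r ?nnegrE// exprn_ge0.
rewrite -[m in S ^+ m]card_ord -prodr_const; apply: ler_prod => i _.
by rewrite v0 vS.
Qed.

Context d (T : measurableType d) (P : probability T R).
Variables (X : int -> {RV P >-> R}) (f : R -> R).
Hypotheses (indepX : mutually_independent X).
Hypotheses (idX : identically_distributed X).
Hypothesis densX : forall t, square_has_density (X t) f.
Hypothesis f_gt0 : forall x, 0 <= x -> 0 < f x.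
Hypothesis varX : forall t, (\int[P]_w (X t w ^+ 2)%:E = 1)%E.

Let delta := fine (P [set w | forgetful alpha k (X^~ w) 0]).
Let E s := [set w | forgetful alpha k (X^~ w) s].
Let S s w : R := \sum_(i < 4) (1 + (omega + alpha) * X (s + i%:Z) w ^+ 2).

Let oa : 0 <= omega + alpha.
Proof. by rewrite addr_ge0// ltW. Qed.

Let S_ge0 s w : 0 <= S s w.
Proof. by apply: sumr_ge0 => i _; rewrite addr_ge0// mulr_ge0// sqr_ge0. Qed.

Let measurable_S d' (T' : measurableType d') (Y : int -> T' -> R) s :
  (forall i : nat, (i < 4)%N -> measurable_fun [set: T'] (Y (s + i%:Z))) ->
  measurable_fun [set: T']
    (fun w => \sum_(i < 4) (1 + (omega + alpha) * Y (s + i%:Z) w ^+ 2)).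
Proof.
move=> mY; apply: measurable_sum => i; apply: measurable_funD => //.
apply: measurable_funM => //; apply: measurable_funX.
exact: mY.
Qed.

Let integral_S s : (\int[P]_w (S s w)%:E = (4 * (1 + (omega + alpha)))%:E)%E.
Proof.
have mX2 t : measurable_fun [set: T] (fun w => (X t w ^+ 2)%:E).
  by apply/measurable_EFinP; apply: measurable_funX; exact: measurable_funPT.
have int1 t : (\int[P]_w (1 + (omega + alpha) * X t w ^+ 2)%:E =
    (1 + (omega + alpha))%:E)%E.
  under eq_integral do rewrite EFinD EFinM.
  rewrite ge0_integralD//; first last.
  - by apply: measurable_funeM; exact: mX2.
  - by move=> w _; rewrite mule_ge0// lee_fin// sqr_ge0.
  rewrite ge0_integralZl_EFin//; last by move=> w _; rewrite lee_fin sqr_ge0.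
  rewrite varX mule1 EFinD (_ : (\int[P]_w 1%:E)%E = 1%:E)//.
  by rewrite (integral_cst _ measurableT) mul1e; exact: probability_setT.
rewrite /S; under eq_integral do rewrite -sumEFin.
rewrite ge0_integral_sum//; last 2 first.
- move=> i; apply/measurable_EFinP; apply: measurable_funD => //.
  apply: measurable_funM => //; apply: measurable_funX.
  exact: measurable_funPT.
- by move=> i w _; rewrite lee_fin addr_ge0// mulr_ge0// sqr_ge0.
under eq_bigr do rewrite int1.
by rewrite sumEFin sumr_const card_ord mulr_natl.
Qed.

Variable n : nat.
Hypothesis n_gt0 : (0 < n)%N.
Let b s w : R := n%:R^-1 * S s w.
Let c s w : R := \1_(~` E s) w * (1 + b s w).
Let r : R := (4 * n)%N%:R^-1.
Let V s j w : R :=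
  (1 + (run omega alpha k (X^~ w) s (0, 0) j).1 ^+ 2) `^ r.

Let b_ge0 s w : 0 <= b s w.
Proof. by rewrite mulr_ge0// invr_ge0. Qed.

Let c_ge0 s w : 0 <= c s w.
Proof. by rewrite mulr_ge0// addr_ge0. Qed.

(** Off the forgetful event, [V] grows at most by the factor [1 + b]; on it, [c] vanishes and the
    previous state is forgotten. *)
Let V_step s j w :
  V s (j + 4) w <= (1 + b (s + j%:Z) w) + c (s + j%:Z) w * V s j w.
Proof.
rewrite /V runD; set z := run _ _ _ _ s _ _; set s' := s + j%:Z.
set W := \prod_(i < 4) (1 + (omega + alpha) * X (s' + i%:Z) w ^+ 2).
have W_ge (i : 'I_4) : 1 <= 1 + (omega + alpha) * X (s' + i%:Z) w ^+ 2.
  by rewrite lerDl mulr_ge0// sqr_ge0.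
have W0 : 0 <= W.
  by apply: prodr_ge0 => i _; exact: le_trans (W_ge i).
have Wr : W `^ r <= 1 + b s' w by exact: prod_root_le.
have z0 : 0 <= 1 + z.1 ^+ 2 by rewrite addr_ge0// sqr_ge0.
have r0 : 0 <= r by rewrite invr_ge0.
have y0 (y : R * R) : 0 <= 1 + y.1 ^+ 2 by rewrite addr_ge0// sqr_ge0.
have VW : (1 + (run omega alpha k (X^~ w) s' z 4).1 ^+ 2) `^ r <=
    (1 + b s' w) * (1 + z.1 ^+ 2) `^ r.
  apply: (@le_trans _ _ (((1 + z.1 ^+ 2) * W) `^ r)).
    apply: ge0_ler_powR; [exact: r0|exact: y0|exact: mulr_ge0|].
    exact: run_growth.
  by rewrite powRM// mulrC ler_wpM2r// powR_ge0.
have EW : E s' w ->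
    (1 + (run omega alpha k (X^~ w) s' z 4).1 ^+ 2) `^ r <= 1 + b s' w.
  (* On the forgetful event the runs from [z] and from [(0, 0)] agree after four steps, so the
     growth bound from [(0, 0)] applies. *)
  move=> wE; have := run_growth (X^~ w) s' (0, 0) 4; rewrite -/W.
  rewrite !(run_forgetful omega_gt0 alpha_ge0 k_gt0 _ wE) expr0n addr0 mul1r.
  move=> h; apply: le_trans Wr.
  by apply: ge0_ler_powR; [exact: r0|exact: y0|exact: W0|].
move: VW EW; set V4 := (X in X <= _); rewrite /c indicE.
case: (boolP (w \in ~` E s')) => wE VW EW.
  by rewrite mul1r (le_trans VW)// lerDr addr_ge0.
rewrite mul0r mul0r addr0; apply: EW.
by move: wE; rewrite notin_setE /= => /contrapT.
Qed.

Lemma measurable_run_moment d' (T' : measurableType d') (Y : int -> T' -> R)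
    s j :
  (forall i : nat, (i < j)%N -> measurable_fun [set: T'] (Y (s + i%:Z))) ->
  measurable_fun [set: T']
    (fun w => (1 + (run omega alpha k (Y^~ w) s (0, 0) j).1 ^+ 2) `^ r).
Proof.
move=> mY; apply: (measurableT_comp (measurable_powR _)).
apply: measurable_funD => //; apply: measurable_funX.
apply: (measurableT_comp measurable_fst); exact: measurable_run.
Qed.

Let beta := n%:R^-1 * (4 * (1 + (omega + alpha))).

Let beta_ge0 : 0 <= beta.
Proof. by rewrite mulr_ge0// mulr_ge0// addr_ge0. Qed.

Let mX t : measurable_fun [set: T] (X t).
Proof. exact: measurable_funPT. Qed.

Let mE s : measurable (E s).
Proof. exact: measurable_forgetful. Qed.

Let mb s : measurable_fun [set: T] (b s).
Proof.
apply: measurable_funM => //; apply: (@measurable_S _ T X) => i _.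
exact: mX.
Qed.

Let mc s : measurable_fun [set: T] (c s).
Proof.
apply: measurable_funM; first by apply: measurable_indic; exact: measurableC.
by apply: measurable_funD => //; exact: mb.
Qed.

Let mV s j : measurable_fun [set: T] (V s j).
Proof. exact: measurable_run_moment. Qed.

Let V_ge0 s j w : 0 <= V s j w.
Proof. exact: powR_ge0. Qed.

Let int_b s : (\int[P]_w (b s w)%:E = beta%:E)%E.
Proof.
under eq_integral do rewrite EFinM.
rewrite ge0_integralZl_EFin//.
- by rewrite integral_S.
- by move=> w _; rewrite lee_fin.
- by apply/measurable_EFinP; apply: (@measurable_S _ T X) => i _; exact: mX.
Qed.

Let int_1b s : (\int[P]_w (1 + b s w)%:E = (1 + beta)%:E)%E.
Proof.
under eq_integral do rewrite EFinD.
rewrite ge0_integralD//; first last.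
- by apply/measurable_EFinP; exact: mb.
- by move=> w _; rewrite lee_fin.
rewrite int_b (_ : (\int[P]_w 1%:E)%E = 1%:E)//.
by rewrite (integral_cst _ measurableT) mul1e; exact: probability_setT.
Qed.

Let int_c s : (\int[P]_w (c s w)%:E <= (1 - delta + beta)%:E)%E.
Proof.
apply: (@le_trans _ _ (\int[P]_w ((\1_(~` E s) w)%:E + (b s w)%:E))%E).
  apply: ge0_le_integral => //.
  - by move=> w _; rewrite lee_fin.
  - by apply/measurable_EFinP; exact: mc.
  - apply: emeasurable_funD; apply/measurable_EFinP; last exact: mb.
    by apply: measurable_indic; exact: measurableC.
  - move=> w _; rewrite -EFinD lee_fin /c mulrDr mulr1 lerD2l ler_piMl//.
rewrite ge0_integralD//; first last.
- by apply/measurable_EFinP; exact: mb.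
- by move=> w _; rewrite lee_fin.
- by apply/measurable_EFinP/measurable_indic; exact: measurableC.
rewrite int_b integral_indic//; last exact: measurableC.
rewrite setIT [X in (X + _ <= _)%E](_ : _ = P (~` E s))//.
rewrite probability_setC//.
by rewrite (forgetful_probability alpha_ge0 k_gt0 indepX idX).
Qed.

(** [V s j] reads innovations before time [s + j], [c (s + j)] only those from that time on. *)
Let int_cV s j : (\int[P]_w (c (s + j%:Z) w * V s j w)%:E =
  (\int[P]_w (c (s + j%:Z) w)%:E) * (\int[P]_w (V s j w)%:E))%E.
Proof.
pose S1 := [set t | s + j%:Z <= t]; pose S2 := [set t | t < s + j%:Z].
pose T1 := g_sigma_algebraType (process_generators X S1).
pose T2 := g_sigma_algebraType (process_generators X S2).
have m1 : measurable_fun [set: T1] (c (s + j%:Z)).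
  apply: measurable_funM.
    apply: measurable_indic; apply: measurableC.
    apply: (@measurable_forgetful _ _ _ _ T1 X) => i _.
    by apply: measurable_process_generators; rewrite /S1 /=; lia.
  apply: measurable_funD => //; apply: measurable_funM => //.
  apply: (@measurable_S _ T1 X) => i _.
  by apply: measurable_process_generators; rewrite /S1 /=; lia.
have m2 : measurable_fun [set: T2] (V s j).
  apply: (@measurable_run_moment _ T2) => i ij.
  by apply: measurable_process_generators; rewrite /S2 /=; lia.
pose C : {RV P >-> R} := mfun_Sub (mem_set (mc (s + j%:Z))).
pose V' : {RV P >-> R} := mfun_Sub (mem_set (mV s j)).
apply: (@ge0_integralM_independent _ _ _ P C V').
- exact: c_ge0.
- exact: V_ge0.
move=> A B mA mB.
apply: (independent_sigma_process indepX (S1 := S1) (S2 := S2)).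
- by apply/disj_setPS => t []; rewrite /S1 /S2 /= leNgt => /negP.
- by have := m1 measurableT A mA; rewrite setTI.
- by have := m2 measurableT B mB; rewrite setTI.
Qed.

Hypothesis beta_le : beta <= delta / 2.
Let K := 2 * (1 + beta) / delta.

(** Induction over blocks of four steps: [beta <= delta / 2] makes the drift ratio
    [1 - delta + beta] at most [1 - delta / 2], and [K * (delta / 2) = 1 + beta] makes the bound [K]
    reproduce itself. *)
Lemma run_moment_le s j : (\int[P]_w (V s (4 * j) w)%:E <= K%:E)%E.
Proof.
have d0 : 0 < delta.
  exact: (forgetful_probability_gt0 alpha_ge0 k_gt0 indepX idX densX f_gt0).
have d1 : delta <= 1.
  exact: (forgetful_probability_le1 alpha_ge0 k_gt0 indepX idX).
have b0 : 0 <= beta := beta_ge0.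
have Kd : K * delta = 2 * (1 + beta) by rewrite /K divfK// gt_eqF.
have K0 : 0 <= K by rewrite divr_ge0 ?mulr_ge0 ?addr_ge0// ltW.
have drift_bound (x y z : R) : x <= y / 2 -> z * y = 2 * (1 + x) -> 0 <= z ->
    1 + x + (1 - y + x) * z <= z.
  move=> xy zy z0; have := ler_wpM2r z0 xy; lra.
elim: j => [|j IHj].
  rewrite muln0 /V /=; under eq_integral do rewrite expr0n addr0 powR1.
  rewrite (integral_cst _ measurableT) mul1e.
  rewrite (_ : _ [set: T] = 1%E); last exact: probability_setT.
  by rewrite lee_fin /K ler_pdivlMr//; lra.
rewrite mulnS addnC; set s' := s + (4 * j)%N%:Z.
apply: (@le_trans _ _ (\int[P]_w ((1 + b s' w)%:E +
    (c s' w * V s (4 * j) w)%:E))%E).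
  apply: ge0_le_integral => //.
  - by move=> w _; rewrite lee_fin.
  - by apply/measurable_EFinP; exact: mV.
  - apply: emeasurable_funD; apply/measurable_EFinP.
      by apply: measurable_funD => //; exact: mb.
    by apply: measurable_funM; [exact: mc|exact: mV].
  - by move=> w _; rewrite -EFinD lee_fin; exact: V_step.
rewrite ge0_integralD//; first last.
- apply/measurable_EFinP.
  by apply: measurable_funM; [exact: mc|exact: mV].
- by move=> w _; rewrite lee_fin mulr_ge0.
- by apply/measurable_EFinP; apply: measurable_funD => //; exact: mb.
- by move=> w _; rewrite lee_fin addr_ge0.
rewrite int_1b int_cV.
apply: (@le_trans _ _ ((1 + beta)%:E + (1 - delta + beta)%:E * K%:E)%E).
  rewrite leeD2l// lee_pmul//.
  - by apply: integral_ge0 => w _; rewrite lee_fin.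
  - by apply: integral_ge0 => w _; rewrite lee_fin.
rewrite -EFinM -EFinD lee_fin.
exact: drift_bound.
Qed.

(** Fatou's lemma along runs started [4 * j] steps in the past, whose moments are bounded by [K]
    uniformly in [j]. *)
Lemma stationary_moment_le t :
  (\int[P]_w (`|stationary omega alpha k (X^~ w) t| `^ (2 * r))%:E <= K%:E)%E.
Proof.
pose F (y : R) : \bar R := ((1 + y ^+ 2) `^ r)%:E.
pose u j w : \bar R := (V (t + 1 - (4 * j)%N%:Z) (4 * j) w)%:E.
have mF : measurable_fun [set: R] F.
  apply/measurable_EFinP; apply: (measurableT_comp (measurable_powR _)).
  by apply: measurable_funD => //; exact: measurable_funX.
have mst := measurable_stationary_process omega alpha k X t.
have mu j : measurable_fun [set: T] (u j) by apply/measurable_EFinP; exact: mV.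
have u0 j w : (0 <= u j w)%E by rewrite lee_fin.
apply: (@le_trans _ _ (\int[P]_w limn_einf (u^~ w))%E); last first.
  apply: le_trans (fatou P measurableT mu (fun j w _ => u0 j w)) _.
  rewrite limn_einf_lim; apply: lime_le; first exact: is_cvg_einfs.
  apply: nearW => j; apply: le_trans (run_moment_le (t + 1 - (4 * j)%N%:Z) j).
  by apply: ereal_inf_lbound; exists j => /=.
apply: ae_ge0_le_integral.
- exact: measurableT.
- by move=> w _; rewrite lee_fin powR_ge0.
- apply/measurable_EFinP; apply: (measurableT_comp (measurable_powR _)).
  exact: measurableT_comp mst.
- move=> w _; rewrite limn_einf_lim; apply: lime_ge; first exact: is_cvg_einfs.
  by apply: nearW => j; apply: le_ereal_inf_tmp => _ [i _ <-].
- apply: (emeasurable_fun_cvg (fun i w => einfs (u^~ w) i)).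
    by move=> i; exact: measurable_fun_einfs.
  by move=> w _; rewrite limn_einf_lim; exact: is_cvg_einfs.
have := ae_renewed alpha_ge0 k_gt0 indepX idX densX f_gt0.
apply: filterS => w /(_ (t + 1)) [s rs] _.
have [m sm] : exists m : nat, t + 1 - (4 * m)%N%:Z <= s.
  by exists `|(t + 1 - s)%R|%N; lia.
(* Past the renewal [u j w] is constant in [j], so its liminf is the value of [F] at the stationary
   variable. *)
rewrite (@cvg_limn_einf_sup _ (u^~ w)
  (F (stationary omega alpha k (X^~ w) t)) _).1.
  rewrite lee_fin powRrM ge0_ler_powR ?invr_ge0 ?nnegrE//.
  - by rewrite addr_ge0// sqr_ge0.
  - by rewrite powR_mulrn// -normrX ger0_norm ?sqr_ge0// lerDr.
apply: cvg_near_cst; exists m => // j /= mj; rewrite /u /V /F.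
rewrite (@stationaryE _ _ _ _ omega_gt0 alpha_ge0 k_gt0 _
  (t + 1 - (4 * j)%N%:Z) _ (0, 0) (4 * j)%N)//.
  by rewrite subrK.
by apply: renewedS rs; lia.
Qed.

End moments.

(** * Conclusion *)

Section properties_of_the_stationary_process.
Context (R : realType) (omega alpha k : R).
Hypotheses (omega_gt0 : 0 < omega) (alpha_ge0 : 0 <= alpha) (k_gt0 : 0 < k).
Context d (T : measurableType d) (P : probability T R).
Variables (X : int -> {RV P >-> R}) (f : R -> R).
Hypotheses (iidX : iid X).
Hypothesis densX : forall t, square_has_density (X t) f.
Hypothesis f_gt0 : forall x, 0 <= x -> 0 < f x.

Let indepX : mutually_independent X. Proof. by case: iidX. Qed.
Let idX : identically_distributed X. Proof. by case: iidX. Qed.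
Let eps := stationary_process omega alpha k X.

Lemma mutually_independent_shift h :
  mutually_independent (fun t => X (t + h)).
Proof.
move=> s A us mA.
have := @indepX [seq t + h | t <- s] (fun t => A (t - h)).
rewrite !big_map map_inj_uniq; last exact: addIr.
move=> /(_ us (fun=> mA _)) XA.
under eq_bigr => t _ do rewrite -[in A t](addrK h t).
by under [RHS]eq_bigr => t _ do rewrite -[in A t](addrK h t).
Qed.

(** The vector of values at the given times is a fixed measurable function of the innovation path,
    and the shifted path has the same law. *)
Lemma strictly_stationary_stationary_process : strictly_stationary eps.
Proof.
move=> m t h B mB.
pose C := [set x : int -> R |
  B [tuple stationary omega alpha k x (tnth t i) | i < m]].
have sC : <<s cylinders (@coordinate R) setT >> C.
  pose T' := g_sigma_algebraType (cylinders (@coordinate R) setT).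
  have mphi : measurable_fun [set: T'] (fun x =>
      [tuple stationary omega alpha k x (tnth t i) | i < m]).
    apply/measurable_fun_tnthP => i.
    rewrite (_ : _ \o _ = fun x => stationary omega alpha k x (tnth t i)).
      apply: (@measurable_stationary _ _ _ _ _ T' (@coordinate R)).
      move=> s _ _ A mA.
      by rewrite setTI; apply: sub_sigma_algebra; exact: cylinder1.
    by apply/funext => x /=; rewrite tnth_mktuple.
  by have := mphi measurableT B mB; rewrite setTI.
have XhX s (A : set R) : measurable A ->
    P (X (s + h) @^-1` A) = P (X s @^-1` A).
  exact: idX.
have := eq_law_of_independent (mutually_independent_shift h) indepX XhX sC.
rewrite /C /= => <-; congr (P _); apply/funext => w /=; congr (B _).
apply: eq_from_tnth => i; rewrite !tnth_mktuple.
by rewrite -(stationary_shift omega alpha k (X^~ w)).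
Qed.

Lemma solution_stationary_process :
  solution omega alpha k (distribution P (X 0)) eps X.
Proof.
split=> [//|t A mA||t A B mA sB]; first exact: idX.
  exists (volatility_process omega alpha k X) => t.
  have := ae_renewed alpha_ge0 k_gt0 indepX idX densX f_gt0.
  apply: filterS => w rw; split.
  - exact: (stationary_eq omega_gt0 alpha_ge0 k_gt0 t rw).
  - exact: volatility_sqr.
  - exact: volatility_gt0.
apply: (independent_sigma_process indepX (S1 := [set t])
  (S2 := [set s | s < t])).
- by apply/disj_setPS => s /= [->]; rewrite ltxx.
- apply: sub_sigma_algebra; exists t => //; exists A => //.
  by rewrite setTI.
- move: sB; apply: sigma_stationary_process => u v /= vt uv.
  exact: le_lt_trans vt.
Qed.

Let delta := fine (P [set w | forgetful alpha k (X^~ w) 0]).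

Let delta_gt0 : 0 < delta.
Proof.
exact: (forgetful_probability_gt0 alpha_ge0 k_gt0 indepX idX densX f_gt0).
Qed.

Let delta_le1 : delta <= 1.
Proof. exact: (forgetful_probability_le1 alpha_ge0 k_gt0 indepX idX). Qed.

(** With [rho = 1 - u / 4], positive even if [u = 1], Bernoulli's inequality gives
    [1 - u <= rho ^+ 4]; dividing the constant by [rho ^+ 3] pays for the remainder of [n] modulo
    4. *)
Lemma geometric_rate_floor (u : R) (v : nat -> \bar R) : 0 < u <= 1 ->
  (forall n, v n <= (2 * (1 - u) ^+ (n %/ 4))%:E)%E -> geometric_rate v.
Proof.
move=> /andP[u0 u1] vu; pose rho := 1 - u / 4.
have r0 : 0 < rho by rewrite /rho; lra.
have r1 : rho < 1 by rewrite /rho; lra.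
have rho4 : 1 - u <= rho ^+ 4.
  rewrite /rho; set y := u / 4; have -> : u = 4 * y by rewrite /y; lra.
  have y0 : 0 < y by rewrite /y; lra.
  have y1 : y <= 4^-1 by rewrite /y; lra.
  have -> : (1 - y) ^+ 4 = ((1 - y) ^+ 2) ^+ 2 by rewrite -exprM.
  have h : 1 - 2 * y <= (1 - y) ^+ 2 by rewrite expr2; nra.
  have h0 : 0 <= 1 - 2 * y by lra.
  have : (1 - 2 * y) ^+ 2 <= ((1 - y) ^+ 2) ^+ 2.
    by rewrite ler_pXn2r// nnegrE sqr_ge0.
  by apply: le_trans; rewrite expr2; nra.
exists (2 / rho ^+ 3), rho; split=> // n; apply: (le_trans (vu n)).
rewrite lee_fin -mulrA ler_wpM2l// mulrC ler_pdivlMr ?exprn_gt0//.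
apply: (@le_trans _ _ ((rho ^+ 4) ^+ (n %/ 4) * rho ^+ 3)).
  rewrite ler_wpM2r ?exprn_ge0 ?(ltW r0)// lerXn2r// nnegrE ?exprn_ge0//.
    by rewrite subr_ge0.
  exact: ltW.
rewrite -exprM -exprD; apply: ler_wiXn2l; [exact: ltW|exact: ltW|].
by have := divn_eq n 4; have := ltn_pmod n (isT : (0 < 4)%N); lia.
Qed.

Lemma almost_independent_stationary_process n A B :
  sigma_process eps [set s | s <= 0] A ->
  sigma_process eps [set s | n%:Z <= s] B ->
  (`|P (A `&` B) - P A * P B| <= (2 * (1 - delta) ^+ (n %/ 4))%:E * P A)%E.
Proof.
apply: stationary_process_almost_independent => //.
by apply: (not_renewed_probability_le alpha_ge0 k_gt0 indepX idX); lia.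
Qed.

Lemma geometrically_beta_mixing_stationary_process :
  geometrically_beta_mixing eps.
Proof.
apply: (@geometric_rate_floor delta); first by rewrite delta_gt0.
move=> n; apply: beta_coef_le.
- exact: sigma_process_sigma_algebra.
- exact: sigma_process_measurable.
- by have [s0 /(_ _ s0)] := sigma_process_sigma_algebra eps [set s | n%:Z <= s];
    rewrite setD0.
- exact: sigma_process_measurable.
- exact: almost_independent_stationary_process.
Qed.

Lemma geometrically_strong_mixing_stationary_process :
  geometrically_strong_mixing eps.
Proof.
apply: (@geometric_rate_floor delta); first by rewrite delta_gt0.
move=> n; apply: alpha_coef_le.
- exact: sigma_process_sigma_algebra.
- exact: sigma_process_measurable.
- by have [s0 /(_ _ s0)] := sigma_process_sigma_algebra eps [set s | n%:Z <= s];
    rewrite setD0.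
- exact: almost_independent_stationary_process.
Qed.

Lemma stationary_process_moment :
  (forall t, 'E_P[fun w => (X t w ^+ 2)%R] = 1)%E ->
  exists2 r : R, 0 < r &
    forall t, ('E_P[fun w => (`|eps t w| `^ (2 * r))%R] < +oo)%E.
Proof.
move=> varX.
have oa : 0 <= 1 + (omega + alpha) by rewrite addr_ge0// addr_ge0// ltW.
(* Any [n >= y] gives [4 * (1 + (omega + alpha)) / n <= delta / 2], the smallness asked of
   [beta]. *)
pose y := 8 * (1 + (omega + alpha)) / delta.
have y0 : 0 <= y by rewrite divr_ge0 ?mulr_ge0// ltW.
pose n := (Num.bound y).+1.
exists (4 * n)%N%:R^-1; first by rewrite invr_gt0 ltr0n.
move=> t; rewrite unlock.
have varX' u : (\int[P]_w (X u w ^+ 2)%:E = 1)%E.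
  by have := varX u; rewrite unlock.
apply: le_lt_trans (ltry _).
apply: (stationary_moment_le omega_gt0 alpha_ge0 k_gt0 indepX idX densX f_gt0
  varX' (n := n)) => //.
rewrite -/delta mulrC ler_pdivrMr ?ltr0n//.
have : y <= n%:R.
  by rewrite (le_trans (ltW (archi_boundP y0)))// ler_nat.
by rewrite /y ler_pdivrMr//; lra.
Qed.

End properties_of_the_stationary_process.

Theorem theorem3p2 (R : realType) (omega alpha k : R)
  (d0 : measure_display) (T0 : measurableType d0) (P0 : probability T0 R)
  (eta0 : int -> {RV P0 >-> R}) (f : R -> R)
  (omega_gt0 : 0 < omega) (alpha_ge0 : 0 <= alpha) (k_gt0 : 0 < k)
  (eta0_iid : iid eta0)
  (eta0_mean : forall t, ('E_P0[eta0 t] = 0)%E)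
  (eta0_var : forall t, ('E_P0[fun w => (eta0 t w ^+ 2)%R] = 1)%E)
  (eta0_density : forall t, square_has_density (eta0 t) f)
  (f_gt0 : forall x, 0 <= x -> 0 < f x) :
  exists (d : measure_display) (T : measurableType d) (P : probability T R)
    (eps eta : int -> {RV P >-> R}),
    [/\ solution omega alpha k (distribution P0 (eta0 0)) eps eta,
        strictly_stationary eps,
        geometrically_beta_mixing eps,
        geometrically_strong_mixing eps &
        exists2 r : R, 0 < r &
          forall t, ('E_P[fun w => (`|eps t w| `^ (2 * r))%R] < +oo)%E].
Proof.
(* The solution is built pathwise from the given innovations, on their own probability space. *)
exists d0, T0, P0, (stationary_process omega alpha k eta0), eta0; split.
- exact: solution_stationary_process eta0_density f_gt0.
- exact: strictly_stationary_stationary_process.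
- exact: geometrically_beta_mixing_stationary_process eta0_density f_gt0.
- exact: geometrically_strong_mixing_stationary_process eta0_density f_gt0.
- exact: stationary_process_moment eta0_density f_gt0 eta0_var.
Qed.
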